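(* Let $G=(V,E,w)$ be an $n$-vertex $\beta$-balanced directed graph with edge weights in $[1, \mathrm{poly}(n)]$, and let $0<\epsilon<1$. There exists a $(1\pm\epsilon)$ for-each cut sketch of $G$ of size $O(n \beta^{1/2} \log^{3} n / \epsilon)$ bits that approximates the value $w(S, V \setminus S)$ of every directed cut $S \subseteq V$ with high probability.
   Context: For $S,T\subseteq V$, $w(S,T)$ is the total weight of edges from $S$ to $T$; $\overline S=V\setminus S$. $G$ is $\beta$-balanced (for $\beta\ge1$) if it is strongly connected and $w(S,\overline S)\le\beta\,w(\overline S,S)$ for all $\varnothing\ne S\subsetneq V$. A (randomized) function $g$ outputs a $(1\pm\epsilon)$ for-each cut sketch of $G$ if there is a recovering function $f$ such that for each fixed $S\subseteq V$, with probability at least $2/3$ (here: with high probability), $(1-\epsilon)w(S,\overline S)\le f(S,g(G))\le(1+\epsilon)w(S,\overline S)$. *)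

(* Defs.v *)
From HB Require Import structures.
From mathcomp Require Import all_boot all_order all_algebra.
From mathcomp Require Import reals exp.
Set Implicit Arguments. Unset Strict Implicit. Unset Printing Implicit Defensive.
Import Order.TTheory GRing.Theory Num.Theory.
Local Open Scope ring_scope.

(* A weighted directed graph on the vertex set 'I_n is given by its weight
   function w : 'I_n -> 'I_n -> R; there is an edge x -> y iff 0 < w x y. *)

Definition wST (R : realType) (n : nat) (w : 'I_n -> 'I_n -> R)
  (S T : {set 'I_n}) : R :=
  \sum_(x in S) \sum_(y in T) w x y.

Definition dcut (R : realType) (n : nat) (w : 'I_n -> 'I_n -> R)
  (S : {set 'I_n}) : R := wST w S (~: S).

Definition weights_poly (R : realType) (n c : nat) (w : 'I_n -> 'I_n -> R) : Prop :=
  forall x y, 0 <= w x y /\ (0 < w x y -> 1 <= w x y <= (n%:R) ^+ c).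

Definition edge_rel (R : realType) (n : nat) (w : 'I_n -> 'I_n -> R) : rel 'I_n :=
  fun x y => 0 < w x y.

Definition strongly_connected (R : realType) (n : nat) (w : 'I_n -> 'I_n -> R) : Prop :=
  forall x y, connect (edge_rel w) x y.

Definition balanced (R : realType) (n : nat) (beta : R) (w : 'I_n -> 'I_n -> R) : Prop :=
  strongly_connected w /\
  forall S : {set 'I_n}, S != set0 -> S != setT ->
    wST w S (~: S) <= beta * wST w (~: S) S.

Definition is_distr (R : realType) (Om : finType) (mu : Om -> R) : Prop :=
  (forall o, 0 <= mu o) /\ \sum_(o : Om) mu o = 1.

Definition prob (R : realType) (Om : finType) (mu : Om -> R) (P : pred Om) : R :=
  \sum_(o : Om | P o) mu o.

(* Main.v *)
Require Import Defs.
From HB Require Import structures.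
From mathcomp Require Import all_boot all_order all_algebra.
From mathcomp Require Import boolp reals sequences exp.
From mathcomp Require Import ring lra zify.
Set Implicit Arguments. Unset Strict Implicit. Unset Printing Implicit Defensive.
Import Order.TTheory GRing.Theory Num.Theory.
Local Open Scope ring_scope.

(* After rounding, the weights are natural numbers.  For each scale d = 2^j,
   split V into classes U that are d-linked: every cut S of the graph has
   undirected weight u(S) >= d * min(|S \cap U|, |U \ S|).  A potential argument
   shows that edges of total weight at most d n log n leave the classes, so the
   edges whose last common class is at scale d have total weight O(d n log n).
   At each scale and for each vertex v, store the 2t heaviest out-edges of v,
   the total weight of the other ones (the tail), and N_v tail edges sampled in
   proportion to their weight, where N_v >= t + (tail of v) * y / d,
   y ~ sqrt beta / eps and t ~ y log n; do the same with in-edges.  To read a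
   cut S, use the out-edges of S \cap U in the classes U where S is a minority
   and the in-edges of U \ S in the other classes.
   Let s be the size of the minority, so that d s <= u(S) <= 3 beta w(S), writing
   w(S) for the directed cut.  If s >= t then d <= 3 beta w(S) / t.  If s < t,
   at least t of the stored edges of v are cut, and each is at least as heavy as
   any of the at most s tail edges that stay inside; so the tail weight inside is
   at most s/t times the cut weight at v.  In both cases the variance is at most
   3 beta w(S)^2 / (t y) = O(eps^2 w(S)^2 / log n), and Bernstein's inequality
   gives high probability without repeating the sketch. *)

(** * Concentration for products of finite distributions *)

Definition prod_distr (R : realType) (I X : finType) (p : I -> X -> R)
  (o : {ffun I -> X}) : R := \prod_i p i (o i).

(** Independence in the form used below: it yields both the marginals and the moment generating
    function of a sum. *)
Lemma sum_prod_distr (R : realType) (I X : finType) (p F : I -> X -> R) :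
  \sum_o prod_distr p o * \prod_i F i (o i) = \prod_i \sum_x p i x * F i x.
Proof.
rewrite bigA_distr_bigA; apply: eq_bigr => o _.
by rewrite /prod_distr -big_split.
Qed.

Lemma prod_distr_is_distr (R : realType) (I X : finType) (p : I -> X -> R) :
  (forall i, is_distr (p i)) -> is_distr (prod_distr p).
Proof.
move=> hp; split=> [o|]; first by apply: prodr_ge0 => i _; case: (hp i) => h _; apply: h.
rewrite /prod_distr -bigA_distr_bigA big1 // => i _.
by case: (hp i).
Qed.

Lemma prod_distr_marginal (R : realType) (I X : finType) (p : I -> X -> R)
    (i0 : I) (P : pred X) :
  (forall i, is_distr (p i)) ->
  prob (prod_distr p) (fun o => P (o i0)) = prob (p i0) P.
Proof.
move=> hp; pose F i x : R := if i == i0 then (P x)%:R else 1.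
have -> : prob (prod_distr p) (fun o => P (o i0))
    = \sum_o prod_distr p o * \prod_i F i (o i).
  rewrite /prob big_mkcond; apply: eq_bigr => o _.
  rewrite (bigD1 i0) //= big1 ?mulr1 => [|i /negbTE ni]; last by rewrite /F ni.
  by rewrite /F eqxx; case: (P _); rewrite ?mulr1 ?mulr0.
rewrite sum_prod_distr (bigD1 i0) //= [X in _ * X]big1 ?mulr1 => [|i /negbTE ni].
  rewrite /prob [RHS]big_mkcond; apply: eq_bigr => x _.
  by rewrite /F eqxx; case: (P x); rewrite ?mulr1 ?mulr0.
rewrite /F ni; under eq_bigr do rewrite mulr1.
by case: (hp i).
Qed.

Lemma prob_compl (R : realType) (Om : finType) (mu : Om -> R) (P : pred Om) :
  is_distr mu -> prob mu P = 1 - prob mu (predC P).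
Proof.
by move=> [_ h1]; rewrite -h1 (bigID P) /= /prob addrK.
Qed.

(** Markov's inequality at threshold 1. *)
Lemma prob_le_sum (R : realType) (Om : finType) (mu F : Om -> R) (P : pred Om) :
  (forall o, 0 <= mu o) -> (forall o, 0 <= F o) -> (forall o, P o -> 1 <= F o) ->
  prob mu P <= \sum_o mu o * F o.
Proof.
move=> h0 F0 F1; rewrite /prob big_mkcond; apply: ler_sum => o _.
case: ifP => [/F1 h|_]; first by rewrite ler_peMr.
by rewrite mulr_ge0.
Qed.

(** From [expR (- y) >= 1 - y] one gets [expR y <= 1 / (1 - y)], and (1 - y)(1 + y + 2y^2) = 1 + y^2
    (1 - 2y) >= 1. *)
Lemma expR_le_quadratic (R : realType) (y : R) :
  `|y| <= 2^-1 -> expR y <= 1 + y + 2 * y ^+ 2.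
Proof.
rewrite ler_norml => /andP[hl hu].
have h1 : 1 - y <= expR (- y) by have := expR_ge1Dx (- y).
rewrite expRN in h1.
have h2 : 0 < 1 - y by lra.
have h3 : expR y <= (1 - y)^-1.
  by rewrite -[expR y]invrK lef_pV2 // posrE invr_gt0 expR_gt0.
apply: (le_trans h3); rewrite -[_^-1]mul1r ler_pdivrMr //.
by have := sqr_ge0 y; nra.
Qed.

(** The linear term of the quadratic bound vanishes by centering. The range is restricted only on
    the support of [p], so a variable that is almost surely constant qualifies whatever its size. *)
Lemma mgf_centered (R : realType) (X : finType) (p Y : X -> R) (s lam : R) :
  is_distr p -> \sum_x p x * Y x = 0 ->
  (forall x, p x != 0 -> `|lam * Y x| <= 2^-1) -> \sum_x p x * Y x ^+ 2 <= s ->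
  \sum_x p x * expR (lam * Y x) <= expR (2 * lam ^+ 2 * s).
Proof.
move=> [p0 p1] hm hb hv.
apply: (@le_trans _ _ (\sum_x p x * (1 + lam * Y x + 2 * (lam * Y x) ^+ 2))).
  apply: ler_sum => x _; have [->|px] := eqVneq (p x) 0; first by rewrite !mul0r.
  by apply: ler_wpM2l => //; apply: expR_le_quadratic; apply: hb.
have -> : \sum_x p x * (1 + lam * Y x + 2 * (lam * Y x) ^+ 2)
   = \sum_x p x + lam * (\sum_x p x * Y x)
     + 2 * lam ^+ 2 * (\sum_x p x * Y x ^+ 2).
  rewrite !mulr_sumr -!big_split /=; apply: eq_bigr => x _; ring.
rewrite p1 hm mulr0 addr0; apply: le_trans (expR_ge1Dx _).
by rewrite lerD2l ler_wpM2l // mulr_ge0 ?sqr_ge0.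
Qed.

(** Exponential Markov inequality followed by factorization over the coordinates. The parameter
    [lam] stays free and is tuned to each cut later. *)
Lemma bernstein_upper (R : realType) (I X : finType) (p Y : I -> X -> R)
    (s : I -> R) (lam delta : R) :
  (forall i, is_distr (p i)) -> (forall i, \sum_x p i x * Y i x = 0) ->
  (forall i x, p i x != 0 -> `|lam * Y i x| <= 2^-1) ->
  (forall i, \sum_x p i x * Y i x ^+ 2 <= s i) ->
  prob (prod_distr p) (fun o => lam * delta < lam * \sum_i Y i (o i))
    <= expR (2 * lam ^+ 2 * (\sum_i s i) - lam * delta).
Proof.
move=> hp hm hb hv.
have [d0 _] := prod_distr_is_distr hp.
pose G o := expR (- (lam * delta)) * \prod_i expR (lam * Y i (o i)).
have G0 o : 0 <= G o.
  by rewrite mulr_ge0 ?expR_ge0 ?prodr_ge0 // => i _; rewrite expR_ge0.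
apply: (@le_trans _ _ (\sum_o prod_distr p o * G o)).
  apply: prob_le_sum => // o.
  rewrite /G -expR_sum -expRD -mulr_sumr => h.
  rewrite -[X in X <= _](@expR0 R) ler_expR; lra.
rewrite /G.
under eq_bigr do rewrite mulrCA.
rewrite -mulr_sumr.
rewrite (sum_prod_distr p (fun i x => expR (lam * Y i x))).
rewrite addrC expRD mulr_sumr expR_sum ler_wpM2l ?expR_ge0 //.
apply: ler_prod => i _; rewrite mgf_centered ?andbT //; last exact: hb.
by apply: sumr_ge0 => x _; case: (hp i) => h _; rewrite mulr_ge0 ?expR_ge0.
Qed.

Lemma bernstein (R : realType) (I X : finType) (p val : I -> X -> R)
    (m s : I -> R) (lam delta : R) :
  (forall i, is_distr (p i)) -> 0 < lam ->
  (forall i, \sum_x p i x * val i x = m i) ->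
  (forall i x, p i x != 0 -> `|lam * (val i x - m i)| <= 2^-1) ->
  (forall i, \sum_x p i x * (val i x - m i) ^+ 2 <= s i) ->
  1 - 2 * expR (2 * lam ^+ 2 * (\sum_i s i) - lam * delta) <=
  prob (prod_distr p)
    (fun o => `|\sum_i val i (o i) - \sum_i m i| <= delta).
Proof.
move=> hp l0 hm hb hv.
have hd := prod_distr_is_distr hp; have [d0 _] := hd.
pose Y i x := val i x - m i.
have hY i : \sum_x p i x * Y i x = 0.
  rewrite /Y; under eq_bigr do rewrite mulrBr.
  by rewrite sumrB hm -mulr_suml; case: (hp i) => _ ->; rewrite mul1r subrr.
rewrite prob_compl // lerD2l lerN2.
have U := bernstein_upper delta hp hY hb hv.
have L : prob (prod_distr p) (fun o => lam * delta < lam * \sum_i - Y i (o i))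
    <= expR (2 * lam ^+ 2 * (\sum_i s i) - lam * delta).
  apply: (@bernstein_upper _ _ _ _ (fun i x => - Y i x)) => // [i|i x px|i].
  - by under eq_bigr do rewrite mulrN; rewrite sumrN hY oppr0.
  - by rewrite mulrN normrN; apply: hb.
  - by under eq_bigr do rewrite sqrrN; apply: hv.
have -> (e : R) : 2 * e = e + e by ring.
apply: le_trans (lerD U L).
rewrite /prob [X in X + _]big_mkcond [X in _ + X]big_mkcond -big_split /=.
rewrite big_mkcond; apply: ler_sum => o _.
have := d0 o; rewrite -ltNge sumrN sumrB /= !ltr_pM2l //.
move: (_ - _) => z dz; rewrite ltr_normr.
by case: (delta < z); case: (delta < - z) => /=; lra.
Qed.

(** * Sampling slots *)

Definition rsum (n : nat) (b : 'I_n -> nat) (Q : {set 'I_n}) : nat :=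
  (\sum_(u in Q) b u)%N.

Lemma rsum_setT (n : nat) (b : 'I_n -> nat) : rsum b setT = (\sum_u b u)%N.
Proof. by apply: eq_bigl => u; rewrite inE. Qed.

Lemma rsumID (n : nat) (b : 'I_n -> nat) (Q : {set 'I_n}) :
  rsum b setT = (rsum b Q + rsum b (~: Q))%N.
Proof.
rewrite rsum_setT (bigID (mem Q)) /=; congr addn.
by apply: eq_bigl => u; rewrite inE.
Qed.

(** An all-zero row falls back to the uniform law, so that every slot has a distribution. *)
Definition slot_distr (R : realType) (n : nat) (b : 'I_n -> nat) (u : 'I_n) : R :=
  if rsum b setT == 0%N then n%:R^-1 else (b u)%:R / (rsum b setT)%:R.

(** The importance-sampling estimator: [den] independent slots with the same row sum to an unbiased
    estimate of the row's weight in [Q]. *)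
Definition slot_value (R : realType) (n : nat) (b : 'I_n -> nat) (den : nat)
  (Q : {set 'I_n}) (u : 'I_n) : R :=
  if u \in Q then (rsum b setT)%:R / den%:R else 0.

Lemma slot_distr_is_distr (R : realType) (n : nat) (b : 'I_n -> nat) :
  (0 < n)%N -> is_distr (@slot_distr R n b).
Proof.
move=> n0; rewrite /slot_distr; split=> [u|].
  by case: ifP => _; rewrite ?invr_ge0 ?divr_ge0 ?ler0n.
case: eqP => [_|/eqP h].
  by rewrite sumr_const card_ord -[LHS]mulr_natr mulVf // pnatr_eq0 -lt0n.
by rewrite -mulr_suml -natr_sum -rsum_setT divff // pnatr_eq0.
Qed.

Lemma sum_slot_distr (R : realType) (n : nat) (b : 'I_n -> nat)
    (Q : {set 'I_n}) :
  rsum b setT != 0%N ->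
  \sum_(u in Q) @slot_distr R n b u = (rsum b Q)%:R / (rsum b setT)%:R.
Proof.
move=> /negbTE h; rewrite /slot_distr h -mulr_suml -natr_sum //.
Qed.

Lemma sum_slot_distr_if (R : realType) (n : nat) (b : 'I_n -> nat)
    (Q : {set 'I_n}) (x y : R) :
  rsum b setT != 0%N ->
  \sum_u slot_distr R b u * (if u \in Q then x else y)
  = ((rsum b Q)%:R * x + (rsum b (~: Q))%:R * y) / (rsum b setT)%:R.
Proof.
move=> h; rewrite (bigID (mem Q)) /= mulrDl; congr (_ + _).
  rewrite (eq_bigr (fun u => slot_distr R b u * x)) => [|u ->] //.
  by rewrite -mulr_suml sum_slot_distr // mulrAC.
rewrite (eq_bigr (fun u => slot_distr R b u * y)) => [|u /negbTE ->] //.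
rewrite -mulr_suml (eq_bigl (mem (~: Q))) => [|u]; last by rewrite /= inE.
by rewrite sum_slot_distr // mulrAC.
Qed.

Lemma slot_mean (R : realType) (n : nat) (b : 'I_n -> nat) (den : nat)
    (Q : {set 'I_n}) :
  \sum_u slot_distr R b u * slot_value R b den Q u = (rsum b Q)%:R / den%:R.
Proof.
have [h|h] := eqVneq (rsum b setT) 0%N.
  have := rsumID b Q; rewrite h => /esym/eqP; rewrite addn_eq0 => /andP[/eqP -> _].
  rewrite /slot_value h !mul0r big1 // => u _.
  by case: ifP; rewrite mulr0.
rewrite sum_slot_distr_if // mulr0 addr0 mulrA mulrAC mulfK //.
by rewrite pnatr_eq0.
Qed.

(** With T the row total and q its part in [Q], the value is T/[den] times a Bernoulli variable of
    mean q/T. The variance vanishes as soon as one side of [Q] carries no weight. *)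
Lemma slot_variance (R : realType) (n : nat) (b : 'I_n -> nat) (den : nat)
    (Q : {set 'I_n}) :
  \sum_u slot_distr R b u * (slot_value R b den Q u - (rsum b Q)%:R / den%:R) ^+ 2
  = (rsum b Q)%:R * (rsum b (~: Q))%:R / den%:R ^+ 2.
Proof.
have [h|h] := eqVneq (rsum b setT) 0%N.
  have := rsumID b Q; rewrite h => /esym/eqP; rewrite addn_eq0 => /andP[/eqP -> _].
  rewrite /slot_value h !mul0r big1 // => u _.
  by case: ifP; rewrite subr0 expr0n mulr0.
set m := _ / _.
have hT : (rsum b setT)%:R != 0 :> R by rewrite pnatr_eq0.
have hs : (rsum b (~: Q))%:R = (rsum b setT)%:R - (rsum b Q)%:R :> R.
  by rewrite (rsumID b Q) natrD addrC addKr.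
transitivity (\sum_u slot_distr R b u *
   (if u \in Q then ((rsum b setT)%:R / den%:R - m) ^+ 2 else m ^+ 2)).
  apply: eq_bigr => u _; congr (_ * _); rewrite /slot_value.
  by case: ifP => // _; rewrite sub0r sqrrN.
rewrite sum_slot_distr_if // hs /m; set T := (rsum b setT)%:R in hT *.
rewrite -mulrBl !expr_div_n -!exprVn; move: den%:R^-1 => i; field.
exact: hT.
Qed.

(** Bernstein's inequality with inactive slots replaced by 0. An active slot either is deterministic
    on its support or has a small range. *)
Lemma slots_concentration (R : realType) (n K : nat) (b : 'I_K -> 'I_n -> nat)
    (den : 'I_K -> nat) (act : pred 'I_K) (Q : 'I_K -> {set 'I_n})
    (lam delta V : R) :
  (0 < n)%N -> 0 < lam ->
  (forall k, act k -> (rsum (b k) (Q k) * rsum (b k) (~: Q k) = 0)%N \/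
     lam * ((rsum (b k) setT)%:R / (den k)%:R) <= 2^-1) ->
  \sum_(k | act k) (rsum (b k) (Q k))%:R * (rsum (b k) (~: Q k))%:R
     / (den k)%:R ^+ 2 <= V ->
  1 - 2 * expR (2 * lam ^+ 2 * V - lam * delta) <=
  prob (prod_distr (fun k => slot_distr R (b k)))
    (fun o => `|\sum_(k | act k) slot_value R (b k) (den k) (Q k) (o k)
                - \sum_(k | act k) (rsum (b k) (Q k))%:R / (den k)%:R| <= delta).
Proof.
move=> n0 l0 hb hV.
pose val k u := if act k then slot_value R (b k) (den k) (Q k) u else 0.
pose m k : R := if act k then (rsum (b k) (Q k))%:R / (den k)%:R else 0.
pose s k : R := if act k then
  (rsum (b k) (Q k))%:R * (rsum (b k) (~: Q k))%:R / (den k)%:R ^+ 2 else 0.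
have hp k := @slot_distr_is_distr R n (b k) n0.
apply: (@le_trans _ _ (1 - 2 * expR (2 * lam ^+ 2 * (\sum_k s k) - lam * delta))).
  rewrite lerD2l lerN2 ler_wpM2l // ler_expR lerD2r ler_wpM2l //.
    by rewrite mulr_ge0 ?sqr_ge0.
  by rewrite /s -big_mkcond.
rewrite [leRHS](_ : _ = prob (prod_distr (fun k => slot_distr R (b k)))
    (fun o => `|\sum_k val k (o k) - \sum_k m k| <= delta)); last first.
  by apply: eq_bigl => o; rewrite /val /m -!big_mkcond.
apply: bernstein => // k.
- rewrite /val /m; case: (act k); first exact: slot_mean.
  by rewrite big1 // => u _; rewrite mulr0.
- move=> u pu; rewrite /val /m; case: ifP => ak; last first.
    by rewrite subrr mulr0 normr0 invr_ge0.
  have [h|h] := eqVneq (rsum (b k) setT) 0%N.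
    have := rsumID (b k) (Q k); rewrite h => /esym/eqP.
    rewrite addn_eq0 => /andP[/eqP -> _].
    by rewrite /slot_value h !mul0r; case: ifP; rewrite subr0 mulr0 normr0 invr_ge0.
  have bu : b k u != 0%N.
    apply: contraNneq pu => bu; rewrite /slot_distr (negbTE h) bu mul0r //.
  have hs : (rsum (b k) setT)%:R = (rsum (b k) (Q k))%:R + (rsum (b k) (~: Q k))%:R :> R.
    by rewrite -natrD -rsumID.
  have i0 : 0 <= (den k)%:R^-1 :> R by rewrite invr_ge0 ler0n.
  have q0 : 0 <= (rsum (b k) (Q k))%:R :> R by [].
  have q0' : 0 <= (rsum (b k) (~: Q k))%:R :> R by [].
  (* If one side of [Q k] has no weight, the value equals the mean on the support; otherwise both
     lie between 0 and row total over denominator. *)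
  case: (hb k ak) => [/eqP|hl].
    rewrite muln_eq0 /slot_value => /orP[] /eqP /= hz.
      have uQ : u \notin Q k.
        by apply: contraNN bu => uQ; move/eqP: hz;
          rewrite sum_nat_eq0 => /forall_inP /(_ _ uQ).
      by rewrite (negbTE uQ) hz mul0r subr0 mulr0 normr0 invr_ge0.
    have uQ : u \in Q k.
      apply: contraNT bu => uQ; move/eqP: hz; rewrite sum_nat_eq0 => /forall_inP; apply.
      by rewrite inE.
    by rewrite uQ hs hz addr0 subrr mulr0 normr0 invr_ge0.
  apply: le_trans hl; rewrite normrM (gtr0_norm l0) ler_pM2l // /slot_value hs.
  move: i0 q0 q0'; move: (rsum _ _)%:R (rsum _ _)%:R _^-1 => x y i i0 x0 y0.
  have := mulr_ge0 x0 i0; have := mulr_ge0 y0 i0.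
  by case: ifP => _; rewrite ler_norml; nra.
- rewrite /val /m /s; case: (act k); first by rewrite slot_variance.
  by rewrite big1 // => u _; rewrite subrr expr0n mulr0.
Qed.

(** * Linked labelings *)

Local Open Scope nat_scope.

Definition cutn (n : nat) (H : 'I_n -> 'I_n -> nat) (S : {set 'I_n}) : nat :=
  \sum_(x in S) \sum_(y in ~: S) H x y.

Definition ucutn (n : nat) (H : 'I_n -> 'I_n -> nat) (S : {set 'I_n}) : nat :=
  cutn H S + cutn H (~: S).

Definition label_class (n : nat) (T : eqType) (l : 'I_n -> T) (v : 'I_n) : {set 'I_n} :=
  [set u | l u == l v].

Definition linked (n : nat) (T : eqType) (H : 'I_n -> 'I_n -> nat) (d : nat)
    (l : 'I_n -> T) : Prop :=
  forall (S : {set 'I_n}) (v : 'I_n),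
    d * minn #|label_class l v :&: S| #|label_class l v :\: S| <= ucutn H S.

Definition separated_weight (n : nat) (T : eqType) (H : 'I_n -> 'I_n -> nat)
    (l : 'I_n -> T) : nat :=
  \sum_x \sum_(y | l x != l y) H x y.

Lemma cutn_mkcond (n : nat) (H : 'I_n -> 'I_n -> nat) (S : {set 'I_n}) :
  cutn H S = \sum_x \sum_y (if (x \in S) && (y \notin S) then H x y else 0).
Proof.
rewrite /cutn big_mkcond; apply: eq_bigr => x _; case: ifP => xS /=.
  by rewrite big_mkcond; apply: eq_bigr => y _; rewrite inE.
by rewrite big1.
Qed.

(** One label more than vertices, so a piece split off a class always finds a fresh label. *)
Lemma unused_label (n : nat) (l : 'I_n -> 'I_n.+1) : exists z, forall u, l u != z.
Proof.
have : #|[set l u | u in 'I_n]| < #|'I_n.+1|.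
  by apply: (leq_ltn_trans (leq_imset_card _ _)); rewrite !card_ord.
rewrite -cardsT => h; have [z _ hz] : exists2 z, z \in setT & z \notin [set l u | u in
  'I_n].
  apply/subsetPn; apply: contraL h => /subset_leq_card h.
  by rewrite -leqNgt.
by exists z => u; apply: contraNneq hz => <-; apply: imset_f.
Qed.

(* Splitting a class along a cut that violates linkedness lowers the potential
   separated weight + d * sum over v of log2 (size of the class of v): every
   vertex of the smaller piece loses at least one unit of the logarithm. *)
Lemma linked_labeling (n : nat) (H : 'I_n -> 'I_n -> nat) (d : nat) :
  exists l : {ffun 'I_n -> 'I_n.+1},
    linked H d l /\ separated_weight H l <= d * (n * trunc_log 2 n).
Proof.
pose ent (l : {ffun 'I_n -> 'I_n.+1}) := \sum_v trunc_log 2 #|label_class l v|.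
pose Phi (l : {ffun 'I_n -> 'I_n.+1}) := separated_weight H l + d * ent l.
pose l0 : {ffun 'I_n -> 'I_n.+1} := [ffun=> ord0].
(* A minimizer of the potential is linked, since no split can improve it; comparison with the
   one-class labeling [l0] bounds its separated weight. *)
have := @arg_minnP _ l0 xpredT Phi isT; set l := arg_min _ _ _ => -[l1 _ hmin].
exists l1; split; last first.
  have h0 : Phi l0 <= d * (n * trunc_log 2 n).
    rewrite /Phi /separated_weight big1 => [|x _]; last first.
      by rewrite big_pred0 // => y; rewrite !ffunE eqxx.
    rewrite add0n leq_mul2l; apply/orP; right.
    rewrite -[X in _ <= X * _]card_ord -sum_nat_const; apply: leq_sum => v _.
    by apply: leq_trunc_log; rewrite -[X in _ <= X]card_ord max_card.
  apply: leq_trans (leq_addr _ _) (leq_trans (hmin _ isT) h0).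
move=> S v; rewrite leqNgt; apply/negP => hlt.
set U := label_class l1 v in hlt; set A := U :&: S in hlt; set B := U :\: S in hlt.
have [z hz] := unused_label l1.
pose l2 : {ffun 'I_n -> 'I_n.+1} := [ffun u => if u \in A then z else l1 u].
have UAB : #|U| = #|A| + #|B| by rewrite -(cardsID S U).
(* Newly separated pairs lie inside [U] and are split by [S], in either direction. *)
have sepP : separated_weight H l2 <= separated_weight H l1 + ucutn H S.
  rewrite /ucutn !cutn_mkcond /separated_weight -!big_split /=.
  apply: leq_sum => x _.
  rewrite big_mkcond [X in _ <= X + _]big_mkcond -!big_split /=.
  apply: leq_sum => y _; rewrite !ffunE !inE.
  have hzx := hz x; have hzy := hz y.
  case: (eqVneq (l1 x) (l1 y)) => [exy|nxy] /=; last first.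
    by case: ifP => // _; lia.
  rewrite exy; case: (l1 y == l1 v) => /=; last by rewrite eqxx.
  by case: (x \in S); case: (y \in S); rewrite /= ?eqxx ?add0n ?addn0 //; case: ifP.
have class2 u : label_class l2 u = if u \in A then A else
   if u \in B then B else label_class l1 u.
  apply/setP => y.
  have -> : (y \in label_class l2 u) = ((if y \in A then z else l1 y) == (if u \in A
    then z else l1 u)).
    by rewrite inE !ffunE.
  have hzu := hz u; have hzy := hz y; rewrite eq_sym in hzu.
  case uA: (u \in A); case yA: (y \in A).
  - by rewrite eqxx.
  - exact/negbTE.
  - move: yA uA; rewrite (negbTE hzu) !inE => /andP[/eqP ey yS].
    case: (eqVneq (l1 u) (l1 v)) => [eu|nu] /=; case uS: (u \in S) => //= _;
    by rewrite !inE ?yS ?ey // eq_sym (negbTE nu).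
  - move: yA uA; rewrite !inE; case: (eqVneq (l1 u) (l1 v)) => [->|nu] /=.
      by move=> yA ->; rewrite /= !inE; move: yA; case: (_ == _); case: (_ \in _).
    by move=> _ _; rewrite andbF inE.
have entP : ent l2 + minn #|A| #|B| <= ent l1.
  (* The smaller piece is at most half of [U], so the logarithm drops by at least 1 on it and
     increases nowhere. *)
  pose C := if #|A| <= #|B| then A else B.
  have -> : minn #|A| #|B| = #|C| by rewrite /C; case: (leqP #|A| #|B|).
  have CU : 2 * #|C| <= #|U| by rewrite UAB /C; case: (leqP #|A| #|B|); lia.
  have Usub u : (u \in A) || (u \in B) -> label_class l1 u = U.
    move=> uAB; have : u \in U by move: uAB; rewrite !inE; case: (l1 u == l1 v);
      rewrite ?andbF.
    by rewrite inE => /eqP e; apply/setP => y; rewrite !inE e.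
  have -> : #|C| = \sum_u (u \in C).
    by rewrite -sum1_card big_mkcond; apply: eq_bigr => u _; case: (u \in C).
  rewrite /ent -big_split /=; apply: leq_sum => u _; rewrite class2.
  have hC : u \in C -> trunc_log 2 #|C| + 1 <= trunc_log 2 #|U|.
    move=> uC; have c0 : 0 < #|C| by apply/card_gt0P; exists u.
    by rewrite addn1 -trunc_log2_double // -mul2n leq_trunc_log.
  case uA: (u \in A).
    rewrite Usub ?uA //; move: hC; rewrite /C; case: (leqP #|A| #|B|) => hAB hC;
      first by rewrite uA; apply: hC.
    have -> : (u \in B) = false by move: uA; rewrite !inE => /andP[_ ->].
    by rewrite addn0 leq_trunc_log // UAB leq_addr.
  case uB: (u \in B).
    rewrite Usub ?uB ?orbT //; move: hC; rewrite /C; case: (leqP #|A| #|B|) => hAB hC;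
      last by rewrite uB; apply: hC.
    by rewrite uA addn0 leq_trunc_log // UAB leq_addl.
  by rewrite /C; case: (leqP #|A| #|B|) => _; rewrite ?uA ?uB addn0.
have := hmin l2 isT; rewrite /Phi leqNgt => /negP; apply.
have : d * (ent l2 + minn #|A| #|B|) <= d * ent l1 by rewrite leq_mul2l entP orbT.
rewrite mulnDr; move: hlt sepP.
move: (ucutn H S) (separated_weight H l2) (separated_weight H l1) => a b c; lia.
Qed.

(** * Rows, levels and keys *)

(** The [tau] heaviest entries, ties broken arbitrarily; the alternative [E = setT] covers types
    with fewer than [tau] elements. *)
Definition top_set (T : finType) (a : T -> nat) (tau : nat) (E : {set T}) : Prop :=
  [/\ #|E| <= tau, #|E| = tau \/ E = setT &
      forall x y, x \in E -> y \notin E -> a y <= a x].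

Lemma top_set_exists (T : finType) (a : T -> nat) (tau : nat) :
  exists E : {set T}, top_set a tau E.
Proof.
elim: tau => [|tau [E [h1 h2 h3]]].
  by exists set0; split; rewrite ?cards0 //; [left | move=> x y; rewrite inE].
case: (eqVneq E setT) => [e|ne].
  by exists E; split=> //; [exact: leqW | right].
have hE : #|E| = tau by case: h2 => // e; rewrite e eqxx in ne.
have [z0 z0E] : exists z0, z0 \notin E.
  have : ~~ (setT \subset E) by rewrite subTset.
  by move=> /subsetPn [z _ hz]; exists z.
have := @arg_maxnP T z0 (fun z => z \notin E) a z0E.
set z1 := arg_max _ _ _ => -[z zE hz].
exists (z |: E); split.
- by rewrite cardsU1 zE hE.
- by left; rewrite cardsU1 zE hE.
- move=> x y; rewrite !inE negb_or => /orP[/eqP -> | xE] /andP[_ yE].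
    exact: hz.
  exact: h3.
Qed.

Definition tail_row (n : nat) (a : 'I_n -> nat) (E : {set 'I_n}) (u : 'I_n) : nat :=
  if u \in E then 0 else a u.

Lemma leq_rsum (n : nat) (a b : 'I_n -> nat) (Q : {set 'I_n}) :
  (forall u, a u <= b u) -> rsum a Q <= rsum b Q.
Proof. by move=> h; apply: leq_sum => u _. Qed.

Lemma tail_row_le (n : nat) (a : 'I_n -> nat) (E : {set 'I_n}) (u : 'I_n) :
  tail_row a E u <= a u.
Proof. by rewrite /tail_row; case: ifP. Qed.

Lemma rsum_tail (n : nat) (a : 'I_n -> nat) (E Q : {set 'I_n}) :
  rsum a Q = \sum_(u in E) (if u \in Q then a u else 0) + rsum (tail_row a E) Q.
Proof.
rewrite /rsum /tail_row [LHS]big_mkcond [X in X + _]big_mkcond.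
rewrite [X in _ = _ + X]big_mkcond -big_split /=.
by apply: eq_bigr => u _; case: (u \in E); case: (u \in Q); rewrite ?addn0 ?add0n.
Qed.

(* When few of the possible neighbours lie outside Q, most of the explicitly
   stored entries go into Q, and each of them dominates every tail entry. *)
Lemma tail_row_few (n : nat) (a : 'I_n -> nat) (t : nat) (E Q U : {set 'I_n}) :
  top_set a (2 * t) E -> (forall u, 0 < a u -> u \in U) ->
  #|U :\: Q| < t ->
  t * rsum (tail_row a E) (~: Q) <= #|U :\: Q| * rsum a Q /\
  rsum (tail_row a E) setT <= rsum a Q.
Proof.
move=> [_ hE htop] hU hs; set s := #|_| in hs *; set b := tail_row a E.
pose m := \max_(u | u \notin E) a u.
have bm u : b u <= m.
  by rewrite /b /tail_row; case: ifPn => // uE;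
    exact: (@leq_bigmax_cond _ (fun u => u \notin E) a u uE).
have bQ : rsum b (~: Q) <= s * m.
  rewrite /rsum -sum_nat_const big_mkcond [X in _ <= X]big_mkcond /=.
  apply: leq_sum => u _; rewrite !inE; case: (u \in Q) => //=.
  case: ifPn => // uU; rewrite leqNgt; apply: contra uU => h.
  by apply: hU; apply: leq_trans h (tail_row_le _ _ _).
have aQ : t * m + rsum b Q <= rsum a Q.
  rewrite (rsum_tail a E Q) leq_add2r.
  (* If the heaviest tail entry [m] is positive, all 2t stored entries are positive and hence lie in
     [U]. At most s < t of them are outside [Q], so at least t lie in [Q], each of weight at least
     [m]. *)
  have [->|m0] := posnP m; first by rewrite muln0.
  have hEm x : x \in E -> m <= a x.
    by move=> xE; apply/bigmax_leqP => y yE; apply: htop.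
  have EU : E \subset U.
    by apply/subsetP => x xE; apply: hU; apply: leq_trans m0 (hEm _ xE).
  have cE : #|E| = 2 * t.
    case: hE => // hT; move: m0; rewrite /m big_pred0 // => u; by rewrite hT inE.
  have cEQ : #|E :\: Q| <= s by apply: subset_leq_card; apply: setSD.
  have cEQ' : t <= #|E :&: Q| by have := cardsID Q E; lia.
  rewrite -big_mkcondr /=; apply: leq_trans (_ : \sum_(u in E :&: Q) m <= _).
    by rewrite sum_nat_const leq_mul2r cEQ' orbT.
  rewrite (eq_bigl (fun u => (u \in E) && (u \in Q))) => [|u]; last by rewrite inE.
  by apply: leq_sum => u /andP[uE _]; apply: hEm.
split.
  apply: leq_trans (_ : t * (s * m) <= _); first by rewrite leq_mul2l bQ orbT.
  rewrite mulnCA leq_mul2l; apply/orP; right; apply: leq_trans aQ; exact: leq_addr.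
rewrite (rsumID b Q) addnC; apply: leq_trans aQ; rewrite leq_add2r.
by apply: (leq_trans bQ); rewrite leq_mul2r (ltnW hs) orbT.
Qed.

(** Combines the case of fewer than [t] possible neighbours outside [Q] with the other one, where
    [d * t <= c]. Here [c] stands for the undirected cut weight; the first conclusion serves the
    variance, the second the range of a sample. *)
Lemma tail_row_tradeoff (n : nat) (a : 'I_n -> nat) (t d c : nat) (E Q U : {set 'I_n}) :
  top_set a (2 * t) E -> (forall u, 0 < a u -> u \in U) ->
  d * #|U :\: Q| <= c ->
  d * t * minn (rsum (tail_row a E) Q) (rsum (tail_row a E) (~: Q)) <= c * rsum a Q /\
  (d * t <= c \/ rsum (tail_row a E) setT <= rsum a Q).
Proof.
move=> hE hU hc; case: (ltnP #|U :\: Q| t) => hs.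
  have [h1 h2] := tail_row_few hE hU hs; split; last by right.
  apply: leq_trans (_ : d * (t * rsum (tail_row a E) (~: Q)) <= _).
    by rewrite -mulnA !leq_mul2l geq_minr !orbT.
  apply: leq_trans (_ : d * (#|U :\: Q| * rsum a Q) <= _);
    first by rewrite leq_mul2l h1 orbT.
  by rewrite mulnA leq_mul2r hc orbT.
have h : d * t <= c by apply: leq_trans hc; rewrite leq_mul2l hs orbT.
split; last by left.
apply: leq_mul h _; apply: leq_trans (geq_minl _ _) _.
by apply: leq_rsum => u; apply: tail_row_le.
Qed.

(** * Assigning edges to scales and splitting a cut into rows *)

Section Levels.
Variables (n L' : nat) (H : 'I_n -> 'I_n -> nat).
Let L := L'.+1.
Variables (T : eqType) (l : 'I_L -> 'I_n -> T).
Hypothesis l_const : forall x y, l ord0 x = l ord0 y.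

(** Labelings of different scales need not be nested, so an edge goes to the last scale at which its
    ends share a class; all later scales separate it. Scale 0 has a single class, so the maximum
    exists. *)
Definition level (x y : 'I_n) : 'I_L := [arg max_(j > ord0 | l j x == l j y) j].

Definition level_weight (j : 'I_L) (x y : 'I_n) : nat :=
  if level x y == j then H x y else 0.

Lemma levelP (x y : 'I_n) :
  l (level x y) x = l (level x y) y /\
  forall j : 'I_L, level x y < j -> l j x != l j y.
Proof.
rewrite /level; case: arg_maxnP => [|j /eqP hj hmax]; first by rewrite (l_const x y).
by split=> // i; apply: contraL => /hmax /=; rewrite -leqNgt.
Qed.

Lemma sum_level_weight (x y : 'I_n) : \sum_j level_weight j x y = H x y.
Proof.
rewrite (bigD1 (level x y)) //= /level_weight eqxx big1 ?addn0 // => j.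
by rewrite eq_sym => /negbTE ->.
Qed.

Lemma level_weight_gt0 (j : 'I_L) (x y : 'I_n) :
  0 < level_weight j x y -> l j x = l j y.
Proof. by rewrite /level_weight; case: eqP => // <- _; case: (levelP x y). Qed.

(** An edge of level j is separated by the labeling of scale j + 1. The top level has no next
    labeling, and there the bound on the total weight takes over. *)
Lemma total_level_weight (N : nat) (j : 'I_L) :
  0 < N -> (forall j : 'I_L, separated_weight H (l j) <= 2 ^ j * N) ->
  \sum_x \sum_y H x y <= 2 ^ L ->
  \sum_x \sum_y level_weight j x y <= 2 ^ j.+1 * N.
Proof.
move=> N0 hsep hL; case: (ltnP j.+1 L) => hj; last first.
  have -> : j.+1 = L by apply/eqP; rewrite eqn_leq ltn_ord.
  apply: leq_trans (leq_pmulr _ N0); apply: leq_trans hL.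
  by do 2 (apply: leq_sum => ? _); rewrite /level_weight; case: ifP.
apply: leq_trans (hsep (Ordinal hj)); rewrite /separated_weight.
apply: leq_sum => x _; rewrite [X in _ <= X]big_mkcond; apply: leq_sum => y _.
rewrite /level_weight; case: eqP => // e.
by have [_ ->] := levelP x y; rewrite //= e.
Qed.

(** A key names one row: a direction ([true] for out-edges), a scale and a vertex. *)
Definition key : finType := (bool * 'I_L * 'I_n)%type.

Definition key_row (k : key) (u : 'I_n) : nat :=
  if k.1.1 then level_weight k.1.2 k.2 u else level_weight k.1.2 u k.2.

Definition key_target (S : {set 'I_n}) (k : key) : {set 'I_n} :=
  if k.1.1 then ~: S else S.

(* A class is read through the out-edges of its vertices in S when S is at most
   half of the class, and through the in-edges of its vertices outside S
   otherwise. *)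
Definition key_active (S : {set 'I_n}) (k : key) : bool :=
  let U := label_class (l k.1.2) k.2 in
  if k.1.1 then (k.2 \in S) && (#|U :&: S| <= #|U :\: S|)
  else (k.2 \notin S) && (#|U :\: S| < #|U :&: S|).

Lemma key_row_gt0 (k : key) (u : 'I_n) :
  0 < key_row k u -> u \in label_class (l k.1.2) k.2.
Proof. by rewrite /key_row inE; case: ifP => _ /level_weight_gt0 ->. Qed.

(** For an active key, the part of the class outside the target is exactly the minority side, so
    linkedness applies to it. *)
Lemma key_active_linked (S : {set 'I_n}) (k : key) :
  (forall j : 'I_L, linked H (2 ^ j) (l j)) -> key_active S k ->
  2 ^ k.1.2 * #|label_class (l k.1.2) k.2 :\: key_target S k| <= ucutn H S.
Proof.
move=> hl; have := hl k.1.2 S k.2; rewrite /key_active /key_target.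
set U := label_class _ _; case: (k.1.1) => + /andP[_ hc].
  by rewrite (minn_idPl hc) setDE setCK.
by rewrite (minn_idPr (ltnW hc)).
Qed.

(** The ends of an edge of level j share their class at scale j, so they agree on which side is the
    minority. Hence each cut edge is read exactly once, from its tail or from its head. *)
Lemma sum_key_rows (S : {set 'I_n}) :
  \sum_(k : key | key_active S k) rsum (key_row k) (key_target S k) = cutn H S.
Proof.
pose G (b : bool) (j : 'I_L) v :=
  if key_active S (b, j, v) then rsum (key_row (b, j, v)) (key_target S (b, j, v)) else 0.
transitivity (\sum_j ((\sum_v G true j v) + \sum_v G false j v)).
  rewrite big_mkcond -(pair_big predT predT
    (fun p v => G p.1 p.2 v)) /= -(pair_big predT predT
    (fun b j => \sum_v G b j v)) /= big_bool -big_split //.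
rewrite cutn_mkcond.
transitivity (\sum_x \sum_y \sum_j
   (if (x \in S) && (y \notin S) then level_weight j x y else 0)); last first.
  do 2 (apply: eq_bigr => ? _); case: ifP => _; last by rewrite big1.
  exact: sum_level_weight.
under [RHS]eq_bigr do rewrite exchange_big.
rewrite [RHS]exchange_big; apply: eq_bigr => j _ /=.
pose sm v := #|label_class (l j) v :&: S| <= #|label_class (l j) v :\: S|.
have hsm x y : 0 < level_weight j x y -> sm x = sm y.
  by move=> /level_weight_gt0 e; rewrite /sm /label_class e.
have -> : \sum_v G true j v = \sum_x \sum_y
   (if (x \in S) && (y \notin S) && sm x then level_weight j x y else 0).
  apply: eq_bigr => x _; rewrite /G /key_active /key_target /key_row /=.
  rewrite -/(sm x) /rsum big_mkcond; case: (x \in S) => /=; last by rewrite big1.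
  case: (sm x); last by rewrite big1 // => y _; rewrite andbF.
  by apply: eq_bigr => y _; rewrite inE andbT.
have -> : \sum_v G false j v = \sum_x \sum_y
   (if (x \in S) && (y \notin S) && ~~ sm y then level_weight j x y else 0).
  rewrite [RHS]exchange_big; apply: eq_bigr => y _.
  rewrite /G /key_active /key_target /key_row /= ltnNge -/(sm y).
  rewrite /rsum big_mkcond; case: (y \in S) => /=.
    by rewrite big1 // => x _; rewrite andbF.
  case: (sm y) => /=; first by rewrite big1 // => x _; rewrite andbF.
  by apply: eq_bigr => x _; rewrite !andbT.
rewrite -big_split; apply: eq_bigr => x _; rewrite -big_split.
apply: eq_bigr => y _ /=; case: ((x \in S) && _) => //=.
have [->|/hsm ->] := posnP (level_weight j x y); first by do 2 case: ifP.
by case: (sm y) => /=; rewrite ?addn0.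
Qed.

End Levels.

(** * The sketch of an integer-weighted graph *)

Lemma leq_sum_div (I : Type) (s : seq I) (F : I -> nat) (d : nat) :
  0 < d -> \sum_(i <- s) F i %/ d <= (\sum_(i <- s) F i) %/ d.
Proof.
move=> d0; rewrite leq_divRL // big_distrl /=; apply: leq_sum => i _.
exact: leq_trunc_div.
Qed.

Lemma sum_nth_pad (R : realType) (X : Type) (x0 : X) (s : seq X) (K : nat) (G : X -> R) :
  size s <= K -> G x0 = 0%R ->
  (\sum_(k < K) G (nth x0 s k) = \sum_(x <- s) G x)%R.
Proof.
move=> hs h0; rewrite -(big_mkord xpredT (fun k => G (nth x0 s k))).
rewrite (big_nth x0) (big_cat_nat (leq0n _) hs) //= [X in (_ + X)%R]big_nat_cond.
rewrite [X in (_ + X)%R]big1 ?addr0 // => k /andP[/andP[hk _] _].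
by rewrite nth_default.
Qed.

Section Slots.
Variables (n L' : nat) (a : key n L' -> 'I_n -> nat) (E : key n L' -> {set 'I_n})
  (N : key n L' -> nat).

Definition slot : Type := (key n L' * ('I_n -> nat) * nat)%type.

(** Puts explicit entries in the format of samples: a row supported at one vertex, used with
    denominator 1, gives a slot without variance. *)
Definition point_row (b : 'I_n -> nat) (u0 u : 'I_n) : nat :=
  if u == u0 then b u else 0.

Definition key_slots (k : key n L') : seq slot :=
  [seq (k, point_row (a k) u, 1) | u <- enum (E k)] ++
  nseq (N k) (k, tail_row (a k) (E k), N k).

Definition slots : seq slot := flatten [seq key_slots k | k <- enum {: key n L'}].

Lemma size_slots : size slots = \sum_k (#|E k| + N k).
Proof.
rewrite size_flatten /shape -map_comp sumnE big_map big_enum /=.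
by apply: eq_bigr => k _; rewrite size_cat size_map size_nseq -cardE.
Qed.

Lemma sum_slots (R : realType) (G : slot -> R) :
  (\sum_(x <- slots) G x = \sum_k (\sum_(u in E k) G (k, point_row (a k) u, 1%N)
      + (N k)%:R * G (k, tail_row (a k) (E k), N k)))%R.
Proof.
rewrite big_flatten big_map big_enum /=; apply: eq_bigr => k _.
rewrite big_cat big_map big_enum /=; congr (_ + _)%R.
by rewrite big_nseq iter_addr_0 mulr_natl.
Qed.

Lemma rsum_point_row (b : 'I_n -> nat) (u : 'I_n) (Q : {set 'I_n}) :
  rsum (point_row b u) Q = if u \in Q then b u else 0.
Proof.
rewrite /rsum big_mkcond (bigD1 u) //= /point_row eqxx big1 ?addn0 // => v /negbTE ->.
by case: ifP.
Qed.

Lemma mem_slots (x0 : slot) (P : slot -> Prop) (i : nat) :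
  P x0 -> (forall k u, u \in E k -> P (k, point_row (a k) u, 1)) ->
  (forall k, 0 < N k -> P (k, tail_row (a k) (E k), N k)) -> P (nth x0 slots i).
Proof.
move=> h0 h1 h2; rewrite /slots; elim: (enum _) i => [|k s IH] i /=.
  by rewrite nth_nil.
rewrite nth_cat; case: ltnP => _; last exact: IH.
rewrite /key_slots nth_cat size_map; case: ltnP => [hi|_].
  have [u0 _] : exists u, u \in E k.
    by apply/card_gt0P; rewrite cardE; apply: leq_trans hi.
  by rewrite (nth_map u0) //; apply: h1; rewrite -mem_enum mem_nth.
rewrite nth_nseq; case: ifP => // h; apply: h2; exact: leq_ltn_trans h.
Qed.

End Slots.

(** The labelings tell the reader which keys are active for a given cut. A slot keeps its key, the
    drawn vertex, the row total and the denominator, but not the row. *)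
Definition sketch (n L' K : nat) : finType :=
  ({ffun 'I_L'.+1 * 'I_n -> 'I_n.+1} *
   {ffun 'I_K -> key n L' * 'I_n * 'I_(2 ^ L'.+1).+1 * 'I_K.+1})%type.

Definition sketch_value (R : realType) (n L' K : nat) (S : {set 'I_n})
    (sk : sketch n L' K) : R :=
  (\sum_k (let: (kk, u, num, den) := sk.2 k in
     if key_active (fun j v => sk.1 (j, v)) S kk && (u \in key_target S kk)
     then (num : nat)%:R / (den : nat)%:R else 0))%R.

Section GraphSketch.
Variables (R : realType) (n L' K y t : nat) (H : 'I_n -> 'I_n -> nat).
Let L := L'.+1.
Let N0 := n * (trunc_log 2 n).+1.
Hypotheses (n_gt1 : 1 < n) (y_gt0 : 0 < y) (t_gt0 : 0 < t).
Hypothesis H_total : \sum_x \sum_y H x y <= 2 ^ L.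
Variable l : 'I_L -> {ffun 'I_n -> 'I_n.+1}.
Hypothesis l_const : forall x y, l ord0 x = l ord0 y.
Hypothesis l_linked : forall j : 'I_L, linked H (2 ^ j) (l j).
Hypothesis l_sep : forall j : 'I_L, separated_weight H (l j) <= 2 ^ j * N0.
(** Two directions and [L] scales; each row uses at most 2t explicit slots and t + 1 samples, and
    the weight-dependent samples add up to at most [2 * y * N0] per direction and scale. *)
Hypothesis K_large : 2 * L * (n * (3 * t + 1) + 2 * y * N0) <= K.

Let lf (j : 'I_L) : 'I_n -> 'I_n.+1 := l j.
Let row := key_row H lf.
Let E (k : key n L') : {set 'I_n} := sval (cid (top_set_exists (row k) (2 * t))).
Let b (k : key n L') := tail_row (row k) (E k).
(** The [+ 1] rounds the quotient up, so that both [y * rsum (b k) setT <= 2 ^ k.1.2 * N k] and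
    [t <= N k] hold. *)
Let N (k : key n L') := (y * rsum (b k) setT) %/ 2 ^ k.1.2 + 1 + t.

Let E_top k : top_set (row k) (2 * t) (E k).
Proof. by rewrite /E; case: cid. Qed.

Let rsum_row_le (k : key n L') :
  rsum (row k) setT <= \sum_x \sum_y H x y.
Proof.
rewrite rsum_setT /row /key_row; case: (k.1.1).
  rewrite [X in _ <= X](bigD1 k.2) //=; apply: leq_trans (leq_addr _ _).
  by apply: leq_sum => u _; rewrite /level_weight; case: ifP.
apply: leq_sum => u _; rewrite [X in _ <= X](bigD1 k.2) //=.
by apply: leq_trans (leq_addr _ _); rewrite /level_weight; case: ifP.
Qed.

(** The rows of one direction and scale together weigh at most 2^(j+1) [N0]; dividing by 2^j leaves
    a bound free of the scale. *)
Let sum_tails (d : bool) (j : 'I_L) :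
  \sum_v (y * rsum (b (d, j, v)) setT) %/ 2 ^ j <= 2 * y * N0.
Proof.
have n0 : 0 < N0 by rewrite muln_gt0 (ltnW n_gt1).
apply: leq_trans (leq_sum_div _ _ _) _; first by rewrite expn_gt0.
have -> : 2 * y * N0 = (y * (2 ^ j.+1 * N0)) %/ 2 ^ j.
  rewrite expnS (_ : y * (2 * 2 ^ j * N0) = 2 * y * N0 * 2 ^ j); last by ring.
  by rewrite mulnK // expn_gt0.
rewrite -big_distrr /= leq_div2r // leq_mul2l; apply/orP; right.
apply: leq_trans (total_level_weight l_const j n0 l_sep H_total).
apply: leq_trans (_ : \sum_v rsum (row (d, j, v)) setT <= _).
  by apply: leq_sum => v _; apply: leq_rsum => u; apply: tail_row_le.
rewrite /row /key_row /=; case: d; last rewrite [X in _ <= X]exchange_big /=;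
  by apply: leq_sum => v _; rewrite rsum_setT.
Qed.

Let sl := slots row E N.

Let size_sl : size sl <= K.
Proof.
apply: leq_trans K_large; rewrite size_slots.
apply: leq_trans (_ : \sum_(k : key n L')
    (3 * t + 1 + (y * rsum (b k) setT) %/ 2 ^ k.1.2) <= _).
  apply: leq_sum => k _; have [h _ _] := E_top k; rewrite /N.
  by move: #|_| (_ %/ _) h => e q; lia.
rewrite -(pair_big predT predT (fun (p : bool * 'I_L) v =>
   3 * t + 1 + (y * rsum (b (p.1, p.2, v)) setT) %/ 2 ^ p.2)) /=.
rewrite -(pair_big predT predT (fun d (j : 'I_L) => \sum_v
   (3 * t + 1 + (y * rsum (b (d, j, v)) setT) %/ 2 ^ j))) /=.
have hj d j : \sum_v (3 * t + 1 + (y * rsum (b (d, j, v)) setT) %/ 2 ^ j)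
    <= n * (3 * t + 1) + 2 * y * N0.
  by rewrite big_split /= sum_nat_const card_ord leq_add2l sum_tails.
apply: leq_trans (_ : \sum_(d : bool) \sum_(j < L) (n * (3 * t + 1) + 2 * y * N0) <= _).
  by apply: leq_sum => d _; apply: leq_sum => j _; apply: hj.
by rewrite !sum_nat_const card_bool card_ord mulnA.
Qed.

Let x0 : slot n L' := ((true, ord0, Ordinal (ltnW n_gt1)), fun=> 0, 0).
Let spec (k : 'I_K) : slot n L' := nth x0 sl k.
Let p := prod_distr (fun k => slot_distr R (spec k).1.2).
Let code (o : {ffun 'I_K -> 'I_n}) : sketch n L' K :=
  ([ffun jv => l jv.1 jv.2],
   [ffun k => ((spec k).1.1, o k, inord (rsum (spec k).1.2 setT), inord (spec k).2)]).

Let N_le (k : key n L') : N k <= K.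
Proof.
apply: leq_trans size_sl; rewrite size_slots (bigD1 k) //=.
by rewrite -addnA addnCA leq_addr.
Qed.

Let rsum_spec k : rsum (spec k).1.2 setT <= 2 ^ L.
Proof.
apply: leq_trans H_total.
apply: (@mem_slots _ _ _ _ _ x0 (fun s => rsum s.1.2 setT <= _)) => [|kk u _|kk _] /=.
- by rewrite /rsum big1.
- by apply: leq_trans (rsum_row_le kk); apply: leq_rsum => v; rewrite /point_row;
    case: ifP.
- by apply: leq_trans (rsum_row_le kk); apply: leq_rsum => v; apply: tail_row_le.
Qed.

Let den_spec k : (spec k).2 <= K.
Proof.
apply: (@mem_slots _ _ _ _ _ x0 (fun s => s.2 <= K)) => [|kk u _|kk _] //=.
apply: leq_trans (N_le kk); rewrite /N addn1; exact: leq_trans (leq_addr _ _).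
Qed.

Let sketch_value_code (S : {set 'I_n}) o :
  sketch_value R S (code o) =
  (\sum_(k | key_active lf S (spec k).1.1)
     slot_value R (spec k).1.2 (spec k).2 (key_target S (spec k).1.1) (o k))%R.
Proof.
rewrite /sketch_value [RHS]big_mkcond; apply: eq_bigr => k _.
rewrite ffunE /=.
have -> : (fun j v => (code o).1 (j, v)) = lf.
  by apply/funext => j; apply/funext => v; rewrite ffunE.
by rewrite !inordK ?ltnS // /slot_value; case: key_active.
Qed.

Let N_gt0 k : 0 < N k.
Proof. by rewrite /N addn1. Qed.

Let sum_spec (G : slot n L' -> R) : G x0 = 0%R ->
  (\sum_k G (spec k) = \sum_k (\sum_(u in E k) G (k, point_row (row k) u, 1%N)
      + (N k)%:R * G (k, b k, N k)))%R.
Proof. by move=> h; rewrite (sum_nth_pad size_sl h) sum_slots. Qed.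

(** The estimator is unbiased: the explicit entries of a row and its [N k] samples of mean tail over
    [N k] restore the full row. *)
Let mean_spec (S : {set 'I_n}) :
  (\sum_(k | key_active lf S (spec k).1.1)
    (rsum (spec k).1.2 (key_target S (spec k).1.1))%:R / (spec k).2%:R
  = (cutn H S)%:R :> R)%R.
Proof.
rewrite -(@sum_key_rows n L' H _ lf l_const) natr_sum [LHS]big_mkcond [RHS]big_mkcond /=.
rewrite (sum_spec (G := fun s => if key_active lf S s.1.1 then
  (rsum s.1.2 (key_target S s.1.1))%:R / s.2%:R else 0)%R); last first.
  by rewrite /= invr0 mulr0; case: ifP.
apply: eq_bigr => k _ /=; case: ifP => ak; last by rewrite big1 ?mulr0 ?addr0.
rewrite (rsum_tail (row k) (E k)) natrD natr_sum mulrCA divff ?mulr1; last first.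
  by rewrite pnatr_eq0 -lt0n.
by congr (_ + _)%R; apply: eq_bigr => u _; rewrite rsum_point_row divr1.
Qed.

(** Inserts the two lower bounds on [N k] into [tail_row_tradeoff], with denominators cleared. The
    result bounds the variance of a row's samples, and the range of one sample by either of two
    quantities. *)
Let tradeoff (S : {set 'I_n}) (k : key n L') : key_active lf S k ->
  rsum (b k) (key_target S k) * rsum (b k) (~: key_target S k) * (t * y) <=
    N k * (ucutn H S * rsum (row k) (key_target S k)) /\
  (rsum (b k) setT * (t * y) <= N k * ucutn H S \/
   rsum (b k) setT * t <= N k * cutn H S).
Proof.
move=> ak; set Q := key_target S k.
have hNy : y * rsum (b k) setT <= 2 ^ k.1.2 * N k.
  rewrite /N mulnDr; apply: leq_trans (leq_addr _ _); apply: ltnW.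
  by rewrite addn1 [X in _ < X]mulnC; apply: ltn_ceil; rewrite expn_gt0.
have hNt : t <= N k by apply: leq_addl.
have [h1 h2] := tail_row_tradeoff (E_top k) (@key_row_gt0 _ _ H _ lf l_const k)
  (key_active_linked l_linked ak).
rewrite -/Q -/(b k) in h1 h2.
(* A product of two parts is at most the smaller part times the total. *)
have hb : rsum (b k) Q * rsum (b k) (~: Q)
   <= minn (rsum (b k) Q) (rsum (b k) (~: Q)) * rsum (b k) setT.
  rewrite (rsumID (b k) Q).
  case: (leqP (rsum (b k) Q) (rsum (b k) (~: Q))) => _;
    first by rewrite leq_mul2l leq_addl orbT.
  by rewrite mulnC leq_mul2l leq_addr orbT.
split.
  apply: leq_trans (leq_mul hb (leqnn _)) _.
  apply: leq_trans (leq_mul (leqnn (N k)) h1).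
  move: hNy; move: (minn _ _) (rsum _ setT) (2 ^ _) => m r d hNy.
  rewrite (_ : m * r * (t * y) = m * t * (y * r)); last by ring.
  rewrite (_ : N k * (d * t * m) = m * t * (d * N k)); last by ring.
  by rewrite leq_mul2l hNy orbT.
case: h2 => h2.
  left; apply: leq_trans (leq_mul (leqnn (N k)) h2).
  move: hNy; move: (rsum _ setT) (2 ^ _) => r d hNy.
  rewrite (_ : r * (t * y) = t * (y * r)); last by ring.
  rewrite (_ : N k * (d * t) = t * (d * N k)); last by ring.
  by rewrite leq_mul2l hNy orbT.
right; rewrite mulnC leq_mul //; apply: leq_trans h2 _.
by rewrite -(@sum_key_rows n L' H _ lf l_const) (bigD1 k) //= leq_addr.
Qed.

(** Explicit entries contribute nothing and the samples of a row at most a multiple of its weight in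
    the target; these weights sum to the cut. *)
Let variance_spec (S : {set 'I_n}) :
  (\sum_(k | key_active lf S (spec k).1.1)
    (rsum (spec k).1.2 (key_target S (spec k).1.1))%:R *
    (rsum (spec k).1.2 (~: key_target S (spec k).1.1))%:R / (spec k).2%:R ^+ 2
  <= (ucutn H S)%:R * (cutn H S)%:R / (t * y)%:R :> R)%R.
Proof.
rewrite -(@sum_key_rows n L' H _ lf l_const) natr_sum mulr_sumr mulr_suml.
rewrite [X in (X <= _)%R]big_mkcond [X in (_ <= X)%R]big_mkcond /=.
rewrite (sum_spec (G := fun s => if key_active lf S s.1.1 then
  (rsum s.1.2 (key_target S s.1.1))%:R * (rsum s.1.2 (~: key_target S s.1.1))%:R
   / s.2%:R ^+ 2 else 0)%R); last first.
  by rewrite /= expr0n invr0 mulr0; case: ifP.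
apply: ler_sum => k _ /=; case: ifP => ak; last by rewrite big1 ?mulr0 ?addr0.
rewrite big1 ?add0r => [|u _]; last first.
  by rewrite !rsum_point_row inE; case: (u \in _); rewrite ?mulr0 ?mul0r.
have [h _] := tradeoff ak.
have hN : (0 < (N k)%:R :> R)%R by rewrite ltr0n.
have hty : (0 < (t * y)%:R :> R)%R by rewrite ltr0n muln_gt0 t_gt0.
move: h; rewrite -(ler_nat R) [X in (X <= _)%R]natrM [X in (X * _ <= _)%R]natrM.
rewrite [X in (_ <= X)%R]natrM [X in (_ <= _ * X)%R]natrM.
move: (rsum _ _)%:R%R (rsum _ _)%:R%R (rsum _ _)%:R%R hN hty => p1 p2 p3.
move: (N k)%:R%R (t * y)%:R%R (ucutn H S)%:R%R => u v w hN hty h.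
rewrite ler_pdivlMr // (_ : _ * v = p3 * p2 * v / u)%R.
  by rewrite ler_pdivrMr // [X in (_ <= X)%R]mulrC.
by field; rewrite gt_eqF.
Qed.

(** The seed and the sketch are chosen before [S], [lam] and [delta]. The two upper bounds on [lam]
    match the two alternatives for the range of a sample. *)
Lemma levels_sketch : exists (q : {ffun 'I_K -> 'I_n} -> R)
    (c : {ffun 'I_K -> 'I_n} -> sketch n L' K),
  is_distr q /\ forall (S : {set 'I_n}) (lam delta : R),
    (0 < lam -> lam * ((ucutn H S)%:R / (t * y)%:R) <= 2^-1 ->
    lam * ((cutn H S)%:R / t%:R) <= 2^-1 ->
    1 - 2 * expR (2 * lam ^+ 2 * ((ucutn H S)%:R * (cutn H S)%:R / (t * y)%:R)
                  - lam * delta) <=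
    prob q (fun o => `|sketch_value R S (c o) - (cutn H S)%:R| <= delta))%R.
Proof.
exists p, code; split.
  by apply: prod_distr_is_distr => k; apply: slot_distr_is_distr; exact: ltnW.
move=> S lam delta l0 hu hW.
rewrite [X in (_ <= X)%R](_ : _ = prob p (fun o =>
  `|\sum_(k | key_active lf S (spec k).1.1)
     slot_value R (spec k).1.2 (spec k).2 (key_target S (spec k).1.1) (o k) -
   \sum_(k | key_active lf S (spec k).1.1)
    (rsum (spec k).1.2 (key_target S (spec k).1.1))%:R / (spec k).2%:R| <= delta))%R.
  apply: slots_concentration => //; first exact: ltnW.
  move=> k; rewrite /spec.
  apply: (@mem_slots _ _ _ _ _ x0 (fun s => key_active lf S s.1.1 ->
    rsum s.1.2 (key_target S s.1.1) * rsum s.1.2 (~: key_target S s.1.1) = 0 \/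
    (lam * ((rsum s.1.2 setT)%:R / s.2%:R) <= 2^-1)%R)) => [|kk u _ _|kk _ ak] /=.
  - by left; rewrite /rsum big1.
  - by left; rewrite !rsum_point_row inE; case: (u \in _); rewrite ?muln0 ?mul0n.
  right; have [_ h] := tradeoff ak.
  have hN : (0 < (N kk)%:R :> R)%R by rewrite ltr0n.
  case: h => h.
    apply: le_trans hu; rewrite ler_pM2l // ler_pdivrMr // mulrAC ler_pdivlMr.
      by rewrite -!natrM ler_nat [X in _ <= X]mulnC.
    by rewrite ltr0n muln_gt0 t_gt0.
  apply: le_trans hW; rewrite ler_pM2l // ler_pdivrMr // mulrAC ler_pdivlMr.
    by rewrite -!natrM ler_nat [X in _ <= X]mulnC.
  by rewrite ltr0n.
by apply: eq_bigl => o; rewrite sketch_value_code mean_spec.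
Qed.

End GraphSketch.

(** At scale 1 the whole vertex set is taken as one class; it is linked because every nontrivial cut
    weighs at least [n]. The higher scales come from [linked_labeling]. *)
Lemma integer_sketch (R : realType) (n L' K y t : nat) (H : 'I_n -> 'I_n -> nat) :
  1 < n -> 0 < y -> 0 < t ->
  (forall S : {set 'I_n}, S != set0 -> S != setT -> n <= ucutn H S) ->
  \sum_x \sum_y H x y <= 2 ^ L'.+1 ->
  2 * L'.+1 * (n * (3 * t + 1) + 2 * y * (n * (trunc_log 2 n).+1)) <= K ->
  exists (q : {ffun 'I_K -> 'I_n} -> R)
         (c : {ffun 'I_K -> 'I_n} -> sketch n L' K),
  is_distr q /\ forall (S : {set 'I_n}) (lam delta : R),
    (0 < lam -> lam * ((ucutn H S)%:R / (t * y)%:R) <= 2^-1 ->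
    lam * ((cutn H S)%:R / t%:R) <= 2^-1 ->
    1 - 2 * expR (2 * lam ^+ 2 * ((ucutn H S)%:R * (cutn H S)%:R / (t * y)%:R)
                  - lam * delta) <=
    prob q (fun o => `|sketch_value R S (c o) - (cutn H S)%:R| <= delta))%R.
Proof.
move=> n1 y0 t0 hcut htot hK.
pose l (j : 'I_L'.+1) : {ffun 'I_n -> 'I_n.+1} :=
  if j == ord0 then [ffun=> ord0] else sval (cid (linked_labeling H (2 ^ j))).
apply: (@levels_sketch R n L' K y t H n1 y0 t0 htot l) => //.
- by move=> x z; rewrite /l eqxx !ffunE.
- move=> j; rewrite /l; case: eqP => [->|_]; last by case: cid => /= ? [].
  move=> S v; rewrite mul1n.
  have -> : label_class ([ffun=> ord0] : {ffun 'I_n -> 'I_n.+1}) v = setT.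
    by apply/setP => u; rewrite !inE !ffunE eqxx.
  rewrite setTI setTD; case: (eqVneq S set0) => [->|S0].
    by rewrite cards0 min0n.
  case: (eqVneq S setT) => [->|ST]; first by rewrite setCT cards0 minn0.
  apply: leq_trans (hcut S S0 ST); apply: leq_trans (geq_minl _ _) _.
  by rewrite -[X in _ <= X]card_ord max_card.
- move=> j; rewrite /l; case: eqP => [->|_].
    rewrite /separated_weight big1 // => x _.
    by rewrite big_pred0 // => z; rewrite !ffunE eqxx.
  case: cid => /= l1 [_ h]; apply: leq_trans h _.
  by rewrite leq_mul2l leq_mul2l leqnSn !orbT.
Qed.

(** * Choice of parameters and bit strings *)

Local Open Scope ring_scope.

(** As [n] is at most e to the power [lg], the failure probability is at most 2 n^-(k+2); the spare
    factor n^2 absorbs the 2. *)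
Lemma failure_bound (R : realType) (n k : nat) (e : R) : (1 < n)%N ->
  (e <= - (k.+2 * (trunc_log 2 n).+1)%N%:R ->
  1 - n%:R ^- k <= 1 - 2 * expR e)%R.
Proof.
move=> n1 he; set lg := (trunc_log 2 n).+1%N in he.
have hn : (n%:R <= expR lg%:R :> R)%R.
  apply: (@le_trans _ _ (2 ^+ lg)%R).
    by rewrite -natrX ler_nat ltnW // trunc_log_ltn.
  rewrite -[lg%:R]mulr1 expRM_natl lerXn2r ?nnegrE ?expR_ge0 //.
  by have := expR_ge1Dx (1 : R)%R.
have n0 : (0 < n%:R :> R)%R by rewrite ltr0n ltnW.
rewrite lerD2l lerN2; apply: (@le_trans _ _ (2 * n%:R ^- k.+2)%R).
  rewrite ler_pM2l //; apply: (@le_trans _ _ (expR (- (k.+2 * lg)%N%:R))).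
    by rewrite ler_expR.
  rewrite expRN natrM expRM_natl lef_pV2 ?posrE ?exprn_gt0 ?expR_gt0 //.
  by rewrite lerXn2r ?nnegrE ?expR_ge0 ?ler0n.
rewrite -[k.+2]addn2 exprD invfM mulrCA ger_pMr ?invr_gt0 ?exprn_gt0 //.
rewrite ler_pdivrMr ?exprn_gt0 // mul1r -natrX ler_nat.
by apply: leq_trans (_ : 2 ^ 2 <= _)%N => //; rewrite leq_exp2r.
Qed.

(** Here y = a r and t = a r [lg]. The choice of [lam] makes the linear term equal to a [lg] / 4 =
    (k + 5) [lg], while [beta <= (eps * r)^2] keeps the quadratic term below (3/2) [lg]. *)
Lemma integer_sketch_accuracy (R : realType) (k lg r : nat) (beta eps u W : R)
    (a := (4 * (k + 5))%N) (lam := (a%:R * lg%:R / (2 * eps * W))%R) :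
  (0 < lg)%N -> (1 <= beta -> 0 < eps -> eps < 1 -> Num.sqrt beta / eps <= r%:R ->
  0 < W -> 0 <= u -> u <= 3 * beta * W ->
  [/\ 0 < lam, lam * (u / (a * r * lg * (a * r))%N%:R) <= 2^-1,
      lam * (W / (a * r * lg)%N%:R) <= 2^-1 &
      2 * lam ^+ 2 * (u * W / (a * r * lg * (a * r))%N%:R) - lam * (eps / 2 * W)
      <= - (k.+2 * lg)%N%:R])%R.
Proof.
move=> lg0 b1 e0 e1 hr W0 u0 hu.
have l0 : (1 <= lg%:R :> R)%R by rewrite (ler_nat _ 1).
have a20 : (20 <= a%:R :> R)%R by rewrite (ler_nat _ 20) /a; lia.
have s1 : (1 <= Num.sqrt beta)%R by rewrite -[1%R]sqrtr1 ler_sqrt ?(le_trans _ b1).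
have hr1 : (Num.sqrt beta <= eps * r%:R)%R by rewrite mulrC -ler_pdivrMr.
have er1 : (1 <= eps * r%:R)%R by apply: le_trans hr1.
have er2 : (beta <= (eps * r%:R) ^+ 2)%R.
  rewrite -[beta]sqr_sqrtr ?(le_trans _ b1) // lerXn2r ?nnegrE ?sqrtr_ge0 //.
  exact: le_trans er1.
have r0 : (0 < r%:R :> R)%R by rewrite -(pmulr_rgt0 _ e0); apply: lt_le_trans er1.
have hk : a%:R = (4 * (k%:R + 5))%R :> R by rewrite /a natrM natrD.
have hu' : (u <= 3 * (eps * r%:R) ^+ 2 * W)%R.
  by apply: le_trans hu _; rewrite ler_pM2r // ler_pM2l.
clear hu; rewrite /lam {lam}; move: a a20 hk => a a20 hk;
  rewrite !natrM -[k.+2%:R]natr1 -[k.+1%:R]natr1.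
move: (a%:R)%R a20 hk => A a20 hk.
move: lg%:R%R r%:R%R l0 er1 er2 r0 hu' {hr hr1} => g x g1 er1 er2 x0 hu.
have g0 : (0 < g)%R by apply: lt_le_trans g1.
have A0 : (0 < A)%R by apply: lt_le_trans a20.
split.
- by rewrite divr_gt0 ?mulr_gt0.
- rewrite [X in X <= _](_ : _ = u / (2 * eps * W * A * x ^+ 2))%R; last first.
    by field; rewrite !gt_eqF.
  rewrite ler_pdivrMr ?mulr_gt0 ?exprn_gt0 //; apply: (le_trans hu).
  rewrite [X in _ <= X](_ : _ = eps * W * A * x ^+ 2)%R; last by field.
  rewrite [X in X <= _](_ : _ = (3 * eps) * (eps * W * x ^+ 2))%R; last by ring.
  rewrite [X in _ <= X](_ : _ = A * (eps * W * x ^+ 2))%R; last by ring.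
  by rewrite ler_pM2r ?mulr_gt0 ?exprn_gt0 //; lra.
- rewrite [X in X <= _](_ : _ = 2^-1 / (eps * x))%R; last by field; rewrite !gt_eqF.
  by rewrite ler_pdivrMr ?mulr_gt0 // ler_peMr // invr_ge0.
rewrite [X in X - _](_ : _ = u * g / (2 * (eps * x) ^+ 2 * W))%R; last first.
  by field; rewrite !gt_eqF.
rewrite [X in _ - X](_ : _ = A * g / 4)%R; last by field; rewrite !gt_eqF.
have h : (u * g / (2 * (eps * x) ^+ 2 * W) <= 3 / 2 * g)%R.
  rewrite ler_pdivrMr ?mulr_gt0 ?exprn_gt0 ?mulr_gt0 //.
  rewrite [X in _ <= X](_ : _ = 3 * (eps * x) ^+ 2 * W * g)%R; last by field.
  by rewrite ler_pM2r.
rewrite hk; lra.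
Qed.

Lemma bit_encoding (T : finType) (m : nat) : (#|T| <= 2 ^ m)%N ->
  exists (enc : T -> seq bool) (dec : seq bool -> option T),
    (forall x, size (enc x) = m) /\ (forall x, dec (enc x) = Some x).
Proof.
move=> hT; have hc : (#|T| <= #|{: m.-tuple bool}|)%N by rewrite card_tuple card_bool.
pose enc (x : T) : m.-tuple bool := enum_val (widen_ord hc (enum_rank x)).
exists enc, (fun s => [pick x | tval (enc x) == s]); split=> x.
  exact: size_tuple.
case: pickP => [x' /eqP|/(_ x)]; last by rewrite eqxx.
move=> /val_inj /enum_val_inj /(congr1 val) /= /val_inj /enum_rank_inj -> //.
Qed.

(** * Rounding and encoding *)

(** Loops cross no cut and are dropped. *)
Definition rounded (R : realType) (n q : nat) (w : 'I_n -> 'I_n -> R)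
    (x y : 'I_n) : nat :=
  if x == y then 0%N else Num.truncn (w x y * q%:R).

(** Otherwise [S] would be closed under edges, and no path could leave it. *)
Lemma crossing_edge (T : finType) (e : rel T) (S : {set T}) :
  (forall x y, connect e x y) -> S != set0 -> S != setT ->
  exists x y, [/\ x \in S, y \notin S & e x y].
Proof.
move=> hc /set0Pn [x xS] ST.
have [z zS] : exists z, z \notin S.
  have : ~~ (setT \subset S) by rewrite subTset.
  by move=> /subsetPn [z _ hz]; exists z.
apply: contrapT => hno.
have step p u : path e u p -> u \in S -> last u p \in S.
  elim: p u => [|v p IH] u //= /andP[euv hp] uS; apply: IH => //.
  by apply: contrapT => /negP vS; apply: hno; exists u, v.
have /connectP [p hp hz] := hc x z.
by move: zS; rewrite hz (step p x).
Qed.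

Section Rounding.
Variables (R : realType) (n c q : nat) (w : 'I_n -> 'I_n -> R) (eps beta : R).
Hypotheses (w_poly : weights_poly c w) (w_bal : balanced beta w).
Hypotheses (eps_gt0 : 0 < eps) (eps_lt1 : eps < 1) (q_eps : 4 <= eps * q%:R)
  (beta_ge1 : 1 <= beta).
Let H := rounded q w.

Let q_gt0 : 0 < q%:R :> R.
Proof. by rewrite -(pmulr_rgt0 _ eps_gt0); apply: lt_le_trans q_eps. Qed.

(** Rounding down loses less than 1, and a positive weight is at least 1, so [q >= 4 / eps] makes
    the relative loss at most eps/4. *)
Lemma rounded_bounds (x y : 'I_n) : x != y ->
  (1 - eps / 4) * (q%:R * w x y) <= (H x y)%:R <= q%:R * w x y.
Proof.
move=> /negbTE xy; rewrite /H /rounded xy.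
have [w0 w1] := w_poly x y.
have wq0 : 0 <= w x y * q%:R by rewrite mulr_ge0 // ltW.
have /andP[h1 h2] := truncn_itv wq0.
rewrite [q%:R * _]mulrC h1 andbT.
have [e|ne] := eqVneq (w x y) 0; first by rewrite e mul0r mulr0.
have /andP[w2 _] : 1 <= w x y <= n%:R ^+ c by apply: w1; rewrite lt_neqAle eq_sym ne.
rewrite -natr1 in h2.
have h3 : 4 * 1 <= eps * q%:R * w x y by rewrite ler_pM // ler0n.
lra.
Qed.

Lemma rounded_le (x y : 'I_n) : (H x y <= n ^ c * q)%N.
Proof.
have [xy|xy] := eqVneq x y; first by rewrite /H /rounded xy eqxx.
have /andP[_ h] := rounded_bounds xy.
rewrite -(ler_nat R); apply: le_trans h _.
rewrite natrM natrX mulrC ler_pM2r //.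
have [w0 w1] := w_poly x y.
have [e|ne] := eqVneq (w x y) 0; first by rewrite e exprn_ge0.
by have /andP[_ ->] : 1 <= w x y <= n%:R ^+ c by apply: w1; rewrite lt_neqAle eq_sym ne.
Qed.

Lemma rounded_cut_bounds (S : {set 'I_n}) :
  (1 - eps / 4) * (q%:R * dcut w S) <= (cutn H S)%:R <= q%:R * dcut w S.
Proof.
rewrite /dcut /wST /cutn natr_sum !mulr_sumr; apply/andP; split;
  apply: ler_sum => x xS; rewrite natr_sum !mulr_sumr; apply: ler_sum => y;
  rewrite inE => yS; have xy : x != y by apply: contraNneq yS => <-.
  by have /andP[] := rounded_bounds xy.
by have /andP[] := rounded_bounds xy.
Qed.

Lemma rounded_cut_ge (S : {set 'I_n}) : S != set0 -> S != setT -> (q <= cutn H S)%N.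
Proof.
move=> S0 ST; have [hc _] := w_bal.
have [x [y [xS yS hxy]]] := crossing_edge hc S0 ST.
have xy : x != y by apply: contraNneq yS => <-.
have hH : (q <= H x y)%N.
  rewrite /H /rounded (negbTE xy) truncn_ge_nat; last first.
    by rewrite mulr_ge0 // ltW.
  have [_ /(_ hxy) /andP[h _]] := w_poly x y.
  by rewrite ler_peMl.
apply: leq_trans hH _; rewrite /cutn (bigD1 x) //= (bigD1 y) ?inE //=.
by rewrite -addnA leq_addr.
Qed.

(** Rounding at most halves the cut, so the reverse cut is at most 2 [beta] times the rounded one;
    the forward cut adds at most one more [beta]. *)
Lemma rounded_balanced (S : {set 'I_n}) : S != set0 -> S != setT ->
  (ucutn H S)%:R <= 3 * beta * (cutn H S)%:R.
Proof.
move=> S0 ST; have [_ hb] := w_bal.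
have hS : dcut w (~: S) <= beta * dcut w S.
  rewrite /dcut setCK; have := hb (~: S); rewrite setCK; apply.
    by apply: contraNneq ST => e; rewrite -[S]setCK e setC0.
  by apply: contraNneq S0 => e; rewrite -[S]setCK e setCT.
have /andP[h1 h2] := rounded_cut_bounds S.
have /andP[_ h4] := rounded_cut_bounds (~: S).
have d0 : 0 <= q%:R * dcut w S by apply: le_trans h2.
rewrite natrD.
have h5 : (cutn H (~: S))%:R <= beta * (q%:R * dcut w S).
  apply: le_trans h4 _; rewrite mulrCA ler_pM2l //.
have h6 : q%:R * dcut w S <= 2 * (cutn H S)%:R.
  have h7 : 2^-1 * (q%:R * dcut w S) <= (1 - eps / 4) * (q%:R * dcut w S).
    by rewrite ler_wpM2r //; move: eps_lt1; lra.
  lra.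
have h8 : beta * (q%:R * dcut w S) <= beta * (2 * (cutn H S)%:R).
  by rewrite ler_wpM2l // (le_trans _ beta_ge1).
have h9 : (cutn H S)%:R <= beta * (cutn H S)%:R :> R by rewrite ler_peMl.
lra.
Qed.

(** The estimation and rounding errors fit together because (1 - eps/2)(1 - eps/4) >= 1 - eps. *)
Lemma rounded_accuracy (S : {set 'I_n}) (v : R) :
  `|v - (cutn H S)%:R| <= eps / 2 * (cutn H S)%:R ->
  (1 - eps) * dcut w S <= v / q%:R /\ v / q%:R <= (1 + eps) * dcut w S.
Proof.
have /andP[h1 h2] := rounded_cut_bounds S.
have d0 : 0 <= q%:R * dcut w S by apply: le_trans h2.
rewrite ler_norml => /andP[h3 h4]; rewrite ler_pdivlMr // ler_pdivrMr //.
move: h1 h2 h3 h4 d0; rewrite -!mulrA ![dcut w S * _]mulrC.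
move: (q%:R * dcut w S) (cutn H S)%:R => D W h1 h2 h3 h4 d0.
have k1 : 0 <= (1 - eps / 2) * (W - (1 - eps / 4) * D).
  by rewrite mulr_ge0 // subr_ge0 //; move: eps_lt1; lra.
have k2 : 0 <= (1 + eps / 2) * (D - W).
  by rewrite mulr_ge0 // ?subr_ge0 //; move: eps_gt0; lra.
have k3 : 0 <= eps * D by rewrite mulr_ge0 // ltW.
have k4 : 0 <= eps * (eps * D) by rewrite mulr_ge0 // ltW.
by split; lra.
Qed.

End Rounding.

Lemma finite_weight (n B : nat) (H : 'I_n -> 'I_n -> nat) :
  (forall x y, H x y <= B)%N ->
  exists h : {ffun 'I_n * 'I_n -> 'I_B.+1}, H = fun x y => h (x, y).
Proof.
move=> hB; exists [ffun p => inord (H p.1 p.2)].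
by apply/funext => x; apply/funext => y; rewrite ffunE inordK // ltnS.
Qed.

(* The seed space has to be fixed before the graph is known: it is the product,
   over all integer-weighted graphs, of the seed spaces of their sketches. *)
Lemma sketch_from_rounding (R : realType) (n c k q m : nat) (beta eps : R)
    (X T : finType) (val : {set 'I_n} -> T -> R) :
  1 <= beta -> 0 < eps -> eps < 1 -> 4 <= eps * q%:R -> (#|T| <= 2 ^ m)%N ->
  (forall H : 'I_n -> 'I_n -> nat, (forall x y, H x y <= n ^ c * q)%N ->
     (forall S : {set 'I_n}, S != set0 -> S != setT -> (q <= cutn H S)%N) ->
     (forall S : {set 'I_n}, S != set0 -> S != setT ->
        (ucutn H S)%:R <= 3 * beta * (cutn H S)%:R) ->
     exists (p : X -> R) (code : X -> T), is_distr p /\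
       forall S : {set 'I_n}, S != set0 -> S != setT -> 1 - n%:R ^- k <=
         prob p (fun o => `|val S (code o) - (cutn H S)%:R|
                            <= eps / 2 * (cutn H S)%:R)) ->
  exists (Om : finType) (mu : Om -> R)
         (g : ('I_n -> 'I_n -> R) -> Om -> seq bool)
         (f : {set 'I_n} -> seq bool -> R),
    is_distr mu /\
    forall w : 'I_n -> 'I_n -> R,
      weights_poly c w -> balanced beta w ->
      (forall o : Om, size (g w o) = m) /\
      (forall S : {set 'I_n},
         1 - n%:R ^- k <=
         prob mu (fun o => ((1 - eps) * dcut w S <= f S (g w o))
                           && (f S (g w o) <= (1 + eps) * dcut w S))).
Proof.
move=> b1 e0 e1 hq hT hsk.
pose B := (n ^ c * q)%N; pose Hs : finType := {ffun 'I_n * 'I_n -> 'I_B.+1}.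
pose mat (h : Hs) x y : nat := h (x, y).
pose good (h : Hs) :=
  (forall S : {set 'I_n}, S != set0 -> S != setT -> (q <= cutn (mat h) S)%N) /\
  (forall S : {set 'I_n}, S != set0 -> S != setT ->
     (ucutn (mat h) S)%:R <= 3 * beta * (cutn (mat h) S)%:R :> R).
have goodP w : weights_poly c w -> balanced beta w ->
    exists2 h, good h & mat h = rounded q w.
  move=> wp wb; have [h hh] := finite_weight (rounded_le (q := q) wp e0 hq).
  exists h; last by rewrite /mat hh.
  have hm : mat h = rounded q w by rewrite /mat hh.
  split=> S S0 ST; rewrite hm; first exact: (rounded_cut_ge q wp wb).
  exact: (rounded_balanced wp wb e0 e1 hq b1).
(* Without a good matrix no graph satisfies the hypotheses, and any sketch will do. *)
have [[h0 good0]|nogood] := pselect (exists h, good h); last first.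
  exists unit, (fun=> 1), (fun _ _ => [::]), (fun _ _ => 0); split.
    by split=> //; rewrite sumr_const card_unit.
  by move=> w wp wb; have [h hg _] := goodP w wp wb; case: nogood; exists h.
(* Matrices that are not good borrow the distribution of [h0], so that every factor of the product
   is a distribution. *)
have hall (h : Hs) : exists pc : (X -> R) * (X -> T), is_distr pc.1 /\
   (good h -> forall S : {set 'I_n}, S != set0 -> S != setT -> 1 - n%:R ^- k <=
         prob pc.1 (fun o => `|val S (pc.2 o) - (cutn (mat h) S)%:R|
                            <= eps / 2 * (cutn (mat h) S)%:R)).
  have H1 h' : good h' -> exists (p : X -> R) (code : X -> T), is_distr p /\
       forall S : {set 'I_n}, S != set0 -> S != setT -> 1 - n%:R ^- k <=
         prob p (fun o => `|val S (code o) - (cutn (mat h') S)%:R|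
                            <= eps / 2 * (cutn (mat h') S)%:R).
    by case=> g1 g2; apply: hsk => // x y; rewrite -ltnS ltn_ord.
  have [/H1[p [code [hp hS]]]|ng] := pselect (good h); first by exists (p, code).
  by have [p [code [hp _]]] := H1 h0 good0; exists (p, code).
have [pc hpc] := choice hall.
have [enc [dec [henc hdec]]] := bit_encoding hT.
pose hof (w : 'I_n -> 'I_n -> R) := match pselect (exists2 h, good h & mat h = rounded
  q w) with
  | left e => sval (cid2 e) | right _ => h0 end.
exists {ffun Hs -> X}, (prod_distr (fun h => (pc h).1)).
exists (fun w (o : {ffun Hs -> X}) => enc ((pc (hof w)).2 (o (hof w)))).
(* The two trivial cuts have weight 0 and are answered exactly. *)
exists (fun S s => if (S == set0) || (S == setT) then 0 else
  if dec s is Some x then val S x / q%:R else 0).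
split; first by apply: prod_distr_is_distr => h; case: (hpc h).
move=> w wp wb; split=> [o|S]; first exact: henc.
have pd h : is_distr (pc h).1 by case: (hpc h).
have n0 : 0 <= n%:R ^- k :> R by rewrite invr_ge0 exprn_ge0.
have [hS|] := boolP ((S == set0) || (S == setT)).
  have d0 : dcut w S = 0.
    by case/orP: hS => /eqP ->; rewrite /dcut /wST ?setCT ?big_set0 ?big1 // => x _;
      rewrite big_set0.
  rewrite /prob (eq_bigl xpredT) => [|o]; last by rewrite d0 !mulr0 lexx.
  have [_ ->] := prod_distr_is_distr pd; lra.
rewrite negb_or => /andP[S0 ST].
have [hg hm] : good (hof w) /\ mat (hof w) = rounded q w.
  rewrite /hof; case: pselect => [e|]; last by case; apply: goodP.
  by case: cid2.
have [_ /(_ hg S S0 ST)] := hpc (hof w).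
rewrite hm => h; apply: (le_trans h).
(* Only the coordinate of the seed that belongs to the rounded graph is read. *)
rewrite -(prod_distr_marginal (hof w) _ pd).
have [pd0 _] := prod_distr_is_distr pd.
rewrite /prob big_mkcond [X in _ <= X]big_mkcond; apply: ler_sum => o _.
case: ifP => [h1|_]; last by case: ifP.
by rewrite hdec; have [-> ->] := rounded_accuracy wp e0 e1 hq h1.
Qed.

(** * Size of the sketch *)

Section SketchSize.
Local Open Scope nat_scope.

Lemma ltn_expn2 (m : nat) : m < 2 ^ m.
Proof. by elim: m => // m IH; rewrite expnS; lia. Qed.

(** If log r exceeds [lg] by e, then n e <= 2^[lg] 2^e <= r. *)
Lemma mul_trunc_log_le (n r : nat) : 0 < r ->
  n * trunc_log 2 r <= n * (trunc_log 2 n).+1 + r.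
Proof.
move=> r0; set lg := (trunc_log 2 n).+1.
case: (leqP (trunc_log 2 r) lg) => h.
  by apply: leq_trans (leq_addr _ _); rewrite leq_mul2l h orbT.
rewrite -(subnKC (ltnW h)) mulnDr leq_add2l.
have h2 : 2 ^ lg * 2 ^ (trunc_log 2 r - lg) <= r.
  by rewrite -expnD subnKC ?(ltnW h) // trunc_logP.
apply: leq_trans h2; apply: leq_mul; last exact: ltnW (ltn_expn2 _).
by rewrite ltnW // trunc_log_ltn.
Qed.

Lemma leq_expn2_exp (a b e : nat) : a <= 2 ^ b -> a ^ e <= 2 ^ (b * e).
Proof. by move=> h; case: e => [|e]; rewrite ?muln0 // expnM leq_exp2r. Qed.

Lemma ltn_expn2_lg (n : nat) : n < 2 ^ (trunc_log 2 n).+1.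
Proof. exact: trunc_log_ltn. Qed.

(** Serves the range r > n, where the whole rounded weight matrix is stored. *)
Lemma card_finite_weight (n c r : nat) (lg := (trunc_log 2 n).+1) :
  #|{ffun 'I_n * 'I_n -> 'I_(n ^ c * (4 * r)).+1}|
    <= 2 ^ (n * (n * (lg * c + 4 + trunc_log 2 r))).
Proof.
rewrite card_ffun card_prod !card_ord.
rewrite [n * (n * _)]mulnA [n * n * (_ + _)]mulnC; apply: leq_expn2_exp.
have h : n ^ c * (4 * r) <= 2 ^ (lg * c + (2 + (trunc_log 2 r).+1)).
  rewrite expnD leq_mul ?leq_expn2_exp ?(ltnW (ltn_expn2_lg _)) //.
  by rewrite expnD leq_mul // ltnW // ltn_expn2_lg.
apply: leq_trans (_ : 2 * 2 ^ (lg * c + (2 + (trunc_log 2 r).+1)) <= _).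
  by rewrite mul2n -addnn -addn1 leq_add // expn_gt0.
by rewrite -expnS leq_exp2l //; lia.
Qed.

Lemma finite_weight_bits (n c r : nat) (lg := (trunc_log 2 n).+1) : 0 < n <= r ->
  n * (n * (lg * c + 4 + trunc_log 2 r)) <= (c + 6) * (n * r * lg ^ 3).
Proof.
move=> /andP[n0 nr]; have r0 : 0 < r := leq_trans n0 nr.
have g0 : 0 < lg by [].
have h : n * (lg * c + 4 + trunc_log 2 r) <= (c + 6) * (r * lg).
  rewrite mulnDr; apply: leq_trans (leq_add (leqnn _) (mul_trunc_log_le n r0)) _.
  rewrite -/lg; apply: leq_trans (_ : r * (lg * c + 4) + (r * lg + r) <= _).
    by rewrite leq_add ?leq_mul // leq_add // leq_mul.
  have hr : r <= r * lg by apply: leq_pmulr.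
  rewrite mulnDr mulnDl (mulnC r 4) mulnCA (mulnC c); lia.
apply: leq_trans (leq_mul (leqnn n) h) _.
rewrite (_ : n * _ = (c + 6) * (n * r * lg ^ 1)); last by rewrite expn1; ring.
by rewrite !leq_mul // leq_pexp2l.
Qed.

Lemma card_sketch (n L' K kap : nat) (lg := (trunc_log 2 n).+1) :
  K < 2 ^ kap ->
  #|sketch n L' K| <=
    2 ^ (lg * (L'.+1 * n) + (2 * L'.+1 + 2 * lg + 2 + kap) * K).
Proof.
move=> hK; rewrite /sketch card_prod !card_ffun !card_prod !card_ord card_bool expnD.
apply: leq_mul; apply: leq_expn2_exp; first exact: ltn_expn2_lg.
(* Bits of a slot, in order: direction, scale, vertex, drawn vertex, numerator, denominator. *)
rewrite (_ : 2 * L'.+1 + 2 * lg + 2 + kap =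
  1 + L'.+1 + lg + lg + L'.+2 + kap); last by lia.
rewrite !(expnD _ _ _) !leq_mul //.
- exact: ltnW (ltn_expn2 _).
- exact: ltnW (ltn_expn2_lg _).
- exact: ltnW (ltn_expn2_lg _).
- by rewrite expn1 mul2n -addnn -addn1 leq_add2l expn_gt0.
Qed.

Lemma slot_count_le (n a c r L : nat) (lg := (trunc_log 2 n).+1) :
  0 < a -> 0 < r -> L <= lg * (c + 6) ->
  2 * L * (n * (3 * (a * r * lg) + 1) + 2 * (a * r) * (n * lg))
    <= 12 * a * (c + 6) * (n * r * lg ^ 2).
Proof.
move=> a0 r0 hL.
have h1 : 1 <= a * r * lg by rewrite !muln_gt0 a0 r0.
apply: leq_trans (_ : 2 * (lg * (c + 6)) * (n * (6 * (a * r * lg))) <= _).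
  rewrite leq_mul //; first by rewrite leq_mul.
  rewrite (_ : 2 * (a * r) * (n * lg) = n * (2 * (a * r * lg))); last by ring.
  by rewrite -mulnDr leq_mul //; lia.
by rewrite leq_eqVlt; apply/orP; left; apply/eqP; ring.
Qed.

Lemma slot_count_bits (n r P K : nat) (lg := (trunc_log 2 n).+1) :
  r <= n -> K <= P * (n * r * lg ^ 2) -> K < 2 ^ (P + 4 * lg).
Proof.
move=> rn hK; apply: (leq_ltn_trans hK).
have hn : n <= 2 ^ lg := ltnW (ltn_expn2_lg n).
have h : n * r * lg ^ 2 <= 2 ^ (4 * lg).
  rewrite (_ : 4 * lg = lg + lg + (lg + lg)); last by lia.
  rewrite !(expnD _ _ _) leq_mul //; first by rewrite leq_mul ?(leq_trans rn).
  by rewrite -mulnn leq_mul // ltnW ?ltn_expn2.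
apply: leq_ltn_trans (_ : P * 2 ^ (4 * lg) < _); first by rewrite leq_mul.
by rewrite expnD ltn_mul2r expn_gt0 ltn_expn2.
Qed.

(** The number of slots carries two logarithms and the length of a slot the third. *)
Lemma sketch_bits_le (n c r L P K : nat) (lg := (trunc_log 2 n).+1) :
  0 < r -> L <= lg * (c + 6) -> K <= P * (n * r * lg ^ 2) ->
  lg * (L * n) + (2 * L + 2 * lg + 2 + (P + 4 * lg)) * K
    <= (c + 6 + (2 * c + 20 + P) * P) * (n * r * lg ^ 3).
Proof.
move=> r0 hL hK; have g0 : 0 < lg by [].
rewrite [X in _ <= X]mulnDl leq_add //.
  apply: leq_trans (_ : lg * (lg * (c + 6) * n) <= _); first by rewrite !leq_mul.
  rewrite (_ : lg * (lg * (c + 6) * n) = (c + 6) * (n * 1 * lg ^ 2)); last by ring.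
  apply: leq_mul => //; apply: leq_mul; [exact: leq_mul | exact: leq_pexp2l].
have h : 2 * L + 2 * lg + 2 + (P + 4 * lg) <= (2 * c + 20 + P) * lg.
  have h1 : P <= P * lg by apply: leq_pmulr.
  have -> : (2 * c + 20 + P) * lg = 2 * (lg * c) + 20 * lg + P * lg by ring.
  rewrite mulnDr in hL; lia.
apply: leq_trans (leq_mul h hK) _.
by rewrite leq_eqVlt; apply/orP; left; apply/eqP; rewrite (expnS lg 2); ring.
Qed.

Lemma total_weight_bits (n c r L' : nat) (lg := (trunc_log 2 n).+1)
    (H : 'I_n -> 'I_n -> nat) :
  r <= n -> (forall x y, H x y <= n ^ c * (4 * n * r)) ->
  lg * (c + 4) + 2 <= L' -> \sum_x \sum_y H x y <= 2 ^ L'.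
Proof.
move=> rn hH hL.
have sum_le (F : 'I_n -> nat) M : (forall x, F x <= M) -> \sum_x F x <= n * M.
  by move=> hF; rewrite -[X in _ <= X * _]card_ord -sum_nat_const; apply: leq_sum.
apply: leq_trans (_ : n * (n * (n ^ c * (4 * n * r))) <= _).
  by apply: (sum_le) => x; apply: (sum_le) => y; apply: hH.
apply: leq_trans (_ : n ^ (c + 4) * 4 <= _).
  rewrite expnD (_ : n ^ 4 = n * n * n * n); last by ring.
  apply: leq_trans (_ : n * (n * (n ^ c * (4 * n * n))) <= _); first by rewrite !leq_mul.
  by rewrite leq_eqVlt; apply/orP; left; apply/eqP; ring.
apply: leq_trans (_ : 2 ^ (lg * (c + 4) + 2) <= _); last by rewrite leq_exp2l.
by rewrite [2 ^ (_ + 2)]expnD leq_mul // leq_expn2_exp // ltnW // ltn_expn2_lg.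
Qed.

End SketchSize.

(** * Natural logarithms and the final assembly *)

Lemma trunc_log_ln (R : realType) (n : nat) : (1 < n)%N ->
  (trunc_log 2 n).+1%:R <= 4 * ln n%:R :> R.
Proof.
move=> n1; have n0 : 0 < n%:R :> R by rewrite ltr0n ltnW.
have l2 : 2^-1 <= ln 2 :> R.
  rewrite -ler_expR lnK ?posrE //.
  have := @expR_ge1Dx R (- 2^-1); rewrite expRN => h.
  have e0 := expR_gt0 (2^-1 : R).
  by rewrite -[expR _]invrK invf_ple ?posrE ?invr_gt0 //; apply: le_trans h; lra.
(* The constant 4: the successor at most doubles the logarithm, and [ln 2 >= 1/2] costs another
   factor 2. *)
have t1 : 1 <= (trunc_log 2 n)%:R :> R.
  by rewrite (ler_nat _ 1) trunc_log_gt0.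
have h : (trunc_log 2 n)%:R * ln 2 <= ln n%:R :> R.
  rewrite mulr_natl -lnXn // ler_ln ?posrE ?exprn_gt0 //.
  by rewrite -natrX ler_nat trunc_logP // ltnW.
rewrite -natr1; have := ler_wpM2l (ler0n R (trunc_log 2 n)) l2; lra.
Qed.

(* For every weight-range exponent c (weights in [1, n^c]) and every
   high-probability exponent k there is a constant C such that for all n >= 2,
   beta >= 1, 0 < eps < 1 there is a randomized sketching map g (a function of
   the graph and a random seed drawn from a finite distribution mu) and a
   recovery map f (independent of the graph) such that for every beta-balanced
   graph w on n vertices with weights in [1, n^c]: every sketch has at most
   C * n * sqrt beta * (ln n)^3 / eps bits, and for each fixed S, with
   probability >= 1 - n^-k, f S (g w seed) is a (1 +- eps) approximation of
   w(S, V \ S). *)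
Theorem theorem7 (R : realType) :
  forall c k : nat, exists C : R, 0 < C /\
  forall (n : nat) (beta eps : R),
    (2 <= n)%N -> 1 <= beta -> 0 < eps -> eps < 1 ->
    exists (Om : finType) (mu : Om -> R)
           (g : ('I_n -> 'I_n -> R) -> Om -> seq bool)
           (f : {set 'I_n} -> seq bool -> R),
      is_distr mu /\
      forall w : 'I_n -> 'I_n -> R,
        weights_poly c w -> balanced beta w ->
        (forall o : Om,
           (size (g w o))%:R <= C * n%:R * Num.sqrt beta * (ln (n%:R : R)) ^+ 3 / eps) /\
        (forall S : {set 'I_n},
           1 - (n%:R : R) ^- k <=
           prob mu (fun o => ((1 - eps) * dcut w S <= f S (g w o))
                             && (f S (g w o) <= (1 + eps) * dcut w S))).
Proof.
move=> c k; pose a := (4 * (k + 5))%N; pose P := (12 * a * (c + 6))%N.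
pose C1 := (c + 6 + (2 * c + 20 + P) * P)%N.
have C1_gt0 : (0 < C1)%N by rewrite /C1 -addnA addnCA addn_gt0.
(* 128 = 2 * 4^3, from [r <= 2 * (Num.sqrt beta / eps)] and [lg <= 4 * ln n]. *)
exists (128 * C1%:R); split; first by rewrite mulr_gt0 // ltr0n.
move=> n beta eps n1 b1 e0 e1.
set lg := (trunc_log 2 n).+1.
have s1 : 1 <= Num.sqrt beta by rewrite -[1]sqrtr1 ler_sqrt ?(le_trans _ b1).
have se1 : 1 <= Num.sqrt beta / eps by rewrite ler_pdivlMr // mul1r (le_trans (ltW e1)).
have /andP[hr1 hr2] := truncn_itv (le_trans ler01 se1).
pose r := (Num.truncn (Num.sqrt beta / eps)).+1.
have r_ge : Num.sqrt beta / eps <= r%:R by exact: ltW.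
have r_le : r%:R <= 2 * (Num.sqrt beta / eps) by rewrite -[r%:R]natr1; move: hr1 se1; lra.
have r_eps : 1 <= eps * r%:R.
  by move: r_ge; rewrite ler_pdivrMr // mulrC; apply: le_trans.
suff [m hm [Om [mu [g [f [hmu hg]]]]]] : exists2 m : nat,
    (m <= C1 * (n * r * lg ^ 3))%N &
    exists (Om : finType) (mu : Om -> R)
         (g : ('I_n -> 'I_n -> R) -> Om -> seq bool)
         (f : {set 'I_n} -> seq bool -> R),
    is_distr mu /\
    forall w : 'I_n -> 'I_n -> R,
      weights_poly c w -> balanced beta w ->
      (forall o : Om, size (g w o) = m) /\
      (forall S : {set 'I_n},
         1 - n%:R ^- k <=
         prob mu (fun o => ((1 - eps) * dcut w S <= f S (g w o))
                           && (f S (g w o) <= (1 + eps) * dcut w S))).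
  exists Om, mu, g, f; split=> // w wp wb; have [h1 h2] := hg w wp wb.
  split=> // o; rewrite h1.
  apply: (@le_trans _ _ (C1%:R * (n%:R * (2 * (Num.sqrt beta / eps)) * (4 * ln n%:R) ^+
    3))).
    move: hm; rewrite -(ler_nat R) natrM (natrM R (n * r)) (natrM R n) natrX => hm;
      apply: (le_trans hm).
    rewrite ler_wpM2l ?ler0n // ler_pM ?mulr_ge0 ?exprn_ge0 ?ler0n //.
      by rewrite ler_wpM2l ?ler0n.
    by rewrite lerXn2r ?nnegrE ?trunc_log_ln // (le_trans _ (trunc_log_ln R n1)).
  rewrite le_eqVlt; apply/orP; left; apply/eqP; field.
  by rewrite gt_eqF.
have r0 : (0 < r)%N by [].
(* For r > n the rounded matrix itself fits into the size bound and determines every rounded cut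
   exactly, so a one-point seed suffices. *)
case: (leqP r n) => hrn; last first.
  exists (n * (n * (lg * c + 4 + trunc_log 2 r)))%N.
    apply: leq_trans (finite_weight_bits c _) _; first by rewrite (ltnW n1) ltnW.
    by rewrite leq_mul2r leq_addr orbT.
  apply: (@sketch_from_rounding R n c k (4 * r) _ beta eps unit _
    (fun S (h : {ffun 'I_n * 'I_n -> 'I_(n ^ c * (4 * r)).+1}) =>
      (cutn (fun x y => h (x, y)) S)%:R)) => //.
  - by rewrite natrM mulrCA ler_peMr.
  - exact: card_finite_weight.
  move=> H hH _ _; have [h hh] := finite_weight hH.
  exists (fun=> 1), (fun=> h); split; first by split=> //; rewrite sumr_const card_unit.
  move=> S _ _; rewrite /prob (eq_bigl xpredT) => [|o].
    by rewrite sumr_const card_unit gerBl invr_ge0 exprn_ge0 ?ler0n.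
  by rewrite -hh subrr normr0 mulr_ge0 ?ler0n // divr_ge0 // ltW.
pose L' := (lg * (c + 4) + 1)%N.
have hL : (L'.+1 <= lg * (c + 6))%N by rewrite /L' mulnDr [X in (_ <= X)%N]mulnDr; lia.
pose y := (a * r)%N; pose t := (a * r * lg)%N.
pose K := (2 * L'.+1 * (n * (3 * t + 1) + 2 * y * (n * lg)))%N.
have a0 : (0 < a)%N by rewrite /a muln_gt0 addn_gt0 orbT.
have hK : (K <= P * (n * r * lg ^ 2))%N by apply: slot_count_le.
exists (lg * (L'.+1 * n) + (2 * L'.+1 + 2 * lg + 2 + (P + 4 * lg)) * K)%N.
  exact: sketch_bits_le.
have y0 : (0 < y)%N by rewrite muln_gt0 a0.
have t0 : (0 < t)%N by rewrite muln_gt0 y0.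
(* In the scaling [4 * n * r], the factor 4r controls the rounding error, and the factor n makes
   every nontrivial cut weigh at least n, as the single class at scale 1 requires. *)
apply: (@sketch_from_rounding R n c k (4 * n * r) _ beta eps {ffun 'I_K -> 'I_n}
  (sketch n L' K) (@sketch_value R n L' K)) => //.
- rewrite natrM mulrCA; apply: (@le_trans _ _ (4 * n)%N%:R); last by rewrite ler_peMr.
  by rewrite (ler_nat _ 4) leq_pmulr // ltnW.
- by apply: card_sketch; apply: slot_count_bits hK.
move=> H hH hcut hbal.
have hcut' S : S != set0 -> S != setT -> (n <= ucutn H S)%N.
  move=> S0 ST; apply: leq_trans (leq_addr _ _); apply: leq_trans (hcut S S0 ST).
  by rewrite mulnAC; apply: leq_pmull; rewrite muln_gt0 r0.
have htot : (\sum_x \sum_y H x y <= 2 ^ L'.+1)%N.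
  by apply: (total_weight_bits hrn hH); rewrite /L'; lia.
have [q [code [hq hS]]] := integer_sketch R n1 y0 t0 hcut' htot (leqnn K).
exists q, code; split=> // S S0 ST.
have W0 : 0 < (cutn H S)%:R :> R.
  by rewrite ltr0n; apply: leq_trans (hcut S S0 ST); rewrite !muln_gt0 r0 (ltnW n1).
have [l0 l1 l2 l3] := integer_sketch_accuracy k (lg := lg) isT b1 e0 e1 r_ge W0
  (ler0n R (ucutn H S)) (hbal S S0 ST).
apply: le_trans (hS S _ (eps / 2 * (cutn H S)%:R) l0 l1 l2).
exact: failure_bound.
Qed.
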